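(* For any $F:\mathfrak N_{\mathbb Y}\to\mathbf R$ that is TV-Lip and belongs to $\mathbf D_P$, $$\mathcal E^{U_N}(F)\xrightarrow[N\to\infty]{}\mathcal E(F).$$
   Context: $\mathbb Y$ is a compact Polish space and $\mathfrak N_{\mathbb Y}$ is the set of locally finite (hence finite) integer-valued measures on $\mathbb Y$, i.e. measures $\sum_n p_n\varepsilon_{\zeta_n}$ with distinct points $\zeta_n$ and positive integers $p_n$ ($\varepsilon_x$ is the Dirac mass at $x$), with the vague topology, generated by $\omega\mapsto|\int f\,d\omega|$, $f$ continuous on $\mathbb Y$. $\mathbf M$ is a measure on $\mathbb Y$ with $\mathbf M(\mathbb Y)=1$, and $\mathbf P$ is the law on $\mathfrak N_{\mathbb Y}$ of the Poisson point process of control (intensity) measure $\mathbf M$, with expectation $\mathbf E$. For $x\in\mathbb Y$, $D_xF(\omega)=F(\omega+\varepsilon_x)-F(\omega)$. $\mathbf D_P$ is the set of $F:\mathfrak N_{\mathbb Y}\to\mathbf R$ such that $\mathcal E(F):=\mathbf E\left[\int_{\mathbb Y}|D_xF|^2\,d\mathbf M(x)\right]<\infty$. $F$ is TV-Lip if it is continuous for the vague topology and $|F(\omega)-F(\eta)|\le \operatorname{dist}_{TV}(\omega,\eta)$ for all $\omega,\eta\in\mathfrak N_{\mathbb Y}$, where $\operatorname{dist}_{TV}(\omega,\eta)$ is the total variation distance, i.e. the number of points, counted with multiplicity, at which $\omega$ and $\eta$ differ: $\sum_{x}|\omega(\{x\})-\eta(\{x\})|$. $(\zeta_k^N)_{1\le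 k\le N}$ and $(p_k^N)_{1\le k\le N}$, $N\ge1$, are triangular arrays of points of $\mathbb Y$ and of non-negative numbers such that $\sup_{k\le N}p_k^N=O(1/N)$ and, for any continuous $\mathbf M$-integrable $f:\mathbb Y\to\mathbf R$, $\sum_{k=1}^Nf(\zeta_k^N)p_k^N\to\int f\,d\mathbf M$ as $N\to\infty$. Let $M_1^N,\dots,M_N^N$ be independent, $M_k^N$ Poisson with parameter $p_k^N$ and law $\mu_k^N$ on the non-negative integers, and $U_N(m_1,\dots,m_N)=\sum_{k=1}^Nm_k\varepsilon_{\zeta_k^N}$. Put $\omega^N_{(m)}=\sum_{k\ne m}M_k^N\varepsilon_{\zeta_k^N}$. The image Dirichlet form is $$\mathcal E^{U_N}(F)=\sum_{m=1}^N\mathbf E\left[\left(F(\omega_{(m)}^N+M_m^N\varepsilon_{\zeta_m^N})-\sum_{\tau=0}^\infty F(\omega_{(m)}^N+\tau\varepsilon_{\zeta_m^N})\,\mu_m^N(\tau)\right)^2\right].$$ *)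

(* Defs.v *)
From HB Require Import structures.
From mathcomp Require Import all_boot all_order all_algebra.
From mathcomp Require Import finmap multiset.
From mathcomp Require Import all_classical all_reals all_analysis.
From mathcomp Require Import measurable_realfun.

Set Implicit Arguments.
Unset Strict Implicit.
Unset Printing Implicit Defensive.

Import Order.TTheory GRing.Theory Num.Theory.
Import numFieldNormedType.Exports.

Local Open Scope classical_set_scope.
Local Open Scope ring_scope.

Notation borel T := (g_sigma_algebraType (@open T)).

(* With completeness built into the type, separation turns the pseudometric
   into a complete metric. *)
Definition polish_space (R : realType) (T : completePseudoMetricType R) :=
  hausdorff_space T /\ exists2 D : set T, countable D & dense D.

(* The finite integer-valued measure \sum_n p_n \d_(zeta_n), with distinct
   points zeta_n and positive integers p_n, is encoded by the finitely
   supported function sending zeta_n to p_n, so that w x is the mass of {x};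
   conf_measure recovers the measure. The parameter R is not used here, but
   selects the reals with respect to which the vague topology is defined. *)
Definition conf (R : realType) (Y : ptopologicalType) := {mset Y}%mset.

Section configurations.
Variables (R : realType) (Y : ptopologicalType).

HB.instance Definition _ := Choice.on (conf R Y).
HB.instance Definition _ := isPointed.Build (conf R Y) (@mset0 Y).

Definition conf_add (w1 w2 : conf R Y) : conf R Y := msetD w1 w2.

(* The measure n \d_x. *)
Definition conf_dirac (n : nat) (x : Y) : conf R Y := msetn n x.

Section conf_measure.
Local Open Scope ereal_scope.

Definition conf_measure (w : conf R Y) (A : set (borel Y)) : \bar R :=
  \sum_(x <- finsupp w) (w x)%:R%:E * \d_(x : borel Y) A.

Variable w : conf R Y.

Let conf_measure0 : conf_measure w set0 = 0.
Proof. by rewrite /conf_measure big1// => x _; rewrite measure0 mule0. Qed.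

Let conf_measure_ge0 A : 0 <= conf_measure w A.
Proof. by apply: sume_ge0 => x _; apply: mule_ge0 => //; rewrite lee_fin. Qed.

Let conf_measure_sigma_additive : semi_sigma_additive (conf_measure w).
Proof.
move=> F mF tF mUF.
have -> : conf_measure w (\bigcup_n F n) = \sum_(i <oo) conf_measure w (F i).
  rewrite /conf_measure nneseries_sum; last first.
    by move=> x i _; apply: mule_ge0 => //; rewrite lee_fin.
  apply: eq_bigr => x _; rewrite nneseriesZl//.
  by rewrite measure_semi_bigcup.
by apply: is_cvg_nneseries => n _ _; exact: conf_measure_ge0.
Qed.

HB.instance Definition _ := isMeasure.Build _ _ _ (conf_measure w)
  conf_measure0 conf_measure_ge0 conf_measure_sigma_additive.

End conf_measure.

Definition vague_subbase : set_system (conf R Y) :=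
  [set U | exists (f : Y -> R) (V : set R), [/\ continuous f, open V &
     U = [set w | V `| \int[conf_measure w]_y f y |] ] ].

HB.instance Definition _ :=
  isSubBaseTopological.Build (conf R Y) vague_subbase id.

Definition dist_TV (w1 w2 : conf R Y) : R :=
  \sum_(x \in [set: Y]) `|(w1 x)%:R - (w2 x)%:R : R|.

Definition TV_Lip (F : conf R Y -> R) :=
  continuous F /\ forall w1 w2, `|F w1 - F w2| <= dist_TV w1 w2.

Definition discrete_grad (x : Y) (F : conf R Y -> R) (w : conf R Y) : R :=
  F (conf_add w (conf_dirac 1 x)) - F w.

Definition dirichlet_form (M : probability (borel Y) R)
    (P : probability (borel (conf R Y)) R) (F : conf R Y -> R) : \bar R :=
  (\int[P]_w \int[M]_x (`|discrete_grad x F w| ^+ 2)%:E)%E.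

Definition domain_D (M : probability (borel Y) R)
    (P : probability (borel (conf R Y)) R) : set (conf R Y -> R) :=
  [set F | (dirichlet_form M P F < +oo)%E].

End configurations.

Definition mutually_independent (R : realType) d (T : measurableType d)
    (P : probability T R) (I : finType) d' (T' : measurableType d')
    (X : I -> T -> T') :=
  forall (J : {set I}) (B : I -> set T'), (forall i, measurable (B i)) ->
    P (\bigcap_(i in [set` J]) (X i @^-1` B i)) =
    (\prod_(i in J) P (X i @^-1` B i))%E.

(* The Poisson distribution is taken from poisson_prob, which is the Dirac mass
   at 0 for rate 0, and not from poisson_pmf, which is constantly 1 there. The
   nat argument of poisson_prob is a dummy. *)
Definition poisson_law (R : realType) (rate : R) (k : nat) : R :=
  fine (poisson_prob rate 0%N [set k]).

Definition poisson_process_law (R : realType) (Y : ptopologicalType)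
    (M : probability (borel Y) R) (P : probability (borel (conf R Y)) R) :=
  (forall (A : set (borel Y)) (k : nat), measurable A ->
     P [set w | conf_measure w A = k%:R%:E] =
     (poisson_law (fine (M A)) k)%:E) /\
  (forall (n : nat) (A : 'I_n -> set (borel Y)),
     (forall i, measurable (A i)) -> trivIset setT A ->
     mutually_independent P (fun i (w : conf R Y) => conf_measure w (A i))).

Section image_dirichlet_form.
Variables (R : realType) (Y : ptopologicalType) (N : nat) (zeta : 'I_N -> Y).

Definition conf_omit (m : 'I_N) (mult : 'I_N -> nat) : conf R Y :=
  \big[@conf_add R Y/point]_(k < N | k != m) conf_dirac R (mult k) (zeta k).

Definition image_dirichlet_form d (Omega : measurableType d)
    (Pr : probability Omega R) (M : 'I_N -> {mfun Omega >-> nat})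
    (F : conf R Y -> R) : \bar R :=
  (\sum_(m < N) 'E_Pr[fun w : Omega =>
     let w_m := conf_omit m (fun k => M k w) in
     ((F (conf_add w_m (conf_dirac R (M m w) (zeta m)))
       - limn (series (fun tau : nat =>
           F (conf_add w_m (conf_dirac R tau (zeta m)))
           * fine (distribution Pr (M m) [set tau])))) ^+ 2)%R])%E.

End image_dirichlet_form.

(* Main.v *)
(** Since F is 1-Lipschitz in total variation, G(w, x) = (D_x F(w))^2 lies in
    [0, 1]. A Poisson variable of small rate p_m is 0 or 1 up to probability
    O(p_m^2), so the m-th term of the image form is p_m E[G(w^N, zeta_m)] up to
    O(p_m^2), and sum_m p_m^2 = O(1/N).

    It remains to compare E[int G(w^N, x) M_N(dx)], M_N = sum_k p_k e_(zeta_k),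
    with E[int G(w, x) M(dx)]. Cut Y into finitely many small cells A_i whose
    boundaries are M-null, and move every point to a reference point a_i of its
    cell. By compactness and vague continuity F is uniformly continuous on
    configurations with at most n0 points, so this changes G little except when
    there are more than n0 points, which is unlikely for both processes. After
    the move, G depends only on the numbers of points in the cells; these are
    independent Poisson variables of rates M_N(A_i) and M(A_i), and
    M_N(A_i) -> M(A_i). *)

(* Two obstacles shape the proof. F is known only to be continuous for the vague topology, and no
   metric on configurations is set up: uniform continuity comes from the compact powers Y^n, along
   the map sending (y_1, ..., y_n) to the sum of the Dirac masses at the y_i. Moreover, the form
   integrates over the Borel sets of the vague topology, so the cell counts and the inner integral
   against M must be shown measurable there. This is why the indicators of the cells are required to
   be pointwise limits of continuous functions, and why the inner integral is obtained as a limit of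
   its own discretizations. The Mecke formula E[V_k h(V)] = p_k E[h(V + e_k)] for independent
   Poisson coordinates does most of the probabilistic work. It gives the leading term and the
   remainder of one coordinate, the Poisson law of the number of points in a cell, and the mean
   number of points, which controls large configurations. Cells with M-null boundary come from
   Urysohn functions cut at levels that M does not charge. *)
From HB Require Import structures.
Require Import Defs.
From mathcomp Require Import all_boot all_order all_algebra.
From mathcomp Require Import finmap multiset.
From mathcomp Require Import all_classical all_reals all_analysis.
From mathcomp Require Import measurable_realfun ring lra.

Set Implicit Arguments.
Unset Strict Implicit.
Unset Printing Implicit Defensive.

Import Order.TTheory GRing.Theory Num.Theory.
Import numFieldNormedType.Exports.

Local Open Scope classical_set_scope.
Local Open Scope ring_scope.

(** * Configurations as lists of points *)

Section conf_facts.
Variables (R : realType) (Y : ptopologicalType).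
Implicit Types (w : conf R Y) (x y : Y).

(** The order of this list is arbitrary, so [pts] of a sum is known only up to [perm_eq]. *)
Definition pts w : seq Y := enum_mset w.
Definition conf_of (s : seq Y) : conf R Y := seq_mset s.

Lemma pts_conf_of s : perm_eq (pts (conf_of s)) s.
Proof. exact: perm_eq_seq_mset. Qed.

Lemma conf_of_pts w : conf_of (pts w) = w.
Proof. exact: seq_mset_id. Qed.

Lemma conf_ofE s x : conf_of s x = count_mem x s.
Proof. exact: mset_seqE. Qed.

Lemma conf_of_cat s t : conf_of (s ++ t) = conf_add (conf_of s) (conf_of t).
Proof. by apply/msetP => x; rewrite msetE2 !conf_ofE count_cat. Qed.

Lemma conf_of_nseq n x : conf_of (nseq n x) = conf_dirac R n x.
Proof.
by apply/msetP => y; rewrite conf_ofE msetnE count_nseq /= eq_sym; case: eqP;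
  rewrite ?mul1n ?mul0n.
Qed.

Lemma conf_of_rcons s x :
  conf_of (rcons s x) = conf_add (conf_of s) (conf_dirac R 1 x).
Proof. by rewrite -cats1 conf_of_cat -(conf_of_nseq 1). Qed.

Lemma perm_pts_add w1 w2 : perm_eq (pts (conf_add w1 w2)) (pts w1 ++ pts w2).
Proof.
by rewrite -{1}(conf_of_pts w1) -{1}(conf_of_pts w2) -conf_of_cat pts_conf_of.
Qed.

Lemma pts_dirac n x : pts (conf_dirac R n x) = nseq n x.
Proof. exact: enum_msetn. Qed.

Lemma pts_point : pts point = [::].
Proof. exact: enum_mset0. Qed.

Lemma conf_addA : associative (@conf_add R Y).
Proof. exact: msetDA. Qed.

Lemma conf_addC : commutative (@conf_add R Y).
Proof. exact: msetDC. Qed.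

Lemma conf_add0 : left_id (point : conf R Y) (@conf_add R Y).
Proof. exact: mset0D. Qed.

HB.instance Definition _ := Monoid.isComLaw.Build _ _ _ conf_addA conf_addC conf_add0.

Lemma conf_measureE w (A : set (borel Y)) :
  conf_measure w A = (\sum_(x <- pts w) \d_(x : borel Y) A)%E.
Proof.
rewrite [RHS]big_mset /=; apply: eq_bigr => x _.
rewrite Monoid.iteropE diracE; elim: (w x) => [|n ih]; first by rewrite mul0e.
by rewrite iterS -ih -EFinM mulrS mulrDl mul1r EFinD EFinM.
Qed.

Definition cnt (A : set Y) w : nat := count (mem A) (pts w).

Lemma conf_measure_cnt w (A : set Y) :
  conf_measure w (A : set (borel Y)) = (cnt A w)%:R%:E.
Proof.
rewrite conf_measureE /cnt; elim: (pts w) => [|x s ih]; first by rewrite big_nil.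
by rewrite big_cons ih/= natrD EFinD diracE.
Qed.

Lemma cnt_perm A w s : perm_eq (pts w) s -> cnt A w = count (mem A) s.
Proof. by move=> /permP; apply. Qed.

Local Open Scope ereal_scope.

(** Measures that agree on measurable sets have the same integrals, so the Dirac masses can be
    indexed by positions in [pts w] and handled by [msum]. *)
Lemma ge0_integral_conf w (f : borel Y -> \bar R) : measurable_fun setT f ->
  (forall y, 0 <= f y) ->
  \int[conf_measure w]_y f y = \sum_(x <- pts w) f x.
Proof.
move=> mf f0.
pose m := fun i : nat =>
  \d_(nth point (pts w) i : borel Y) : {measure set (borel Y) -> \bar R}.
rewrite (@eq_measure_integral _ _ _ _
  (msum m (size (pts w)) : {measure set (borel Y) -> \bar R})); last first.
  move=> A mA _; rewrite [LHS](conf_measureE w A).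
  by rewrite (big_nth point) big_mkord.
rewrite ge0_integral_measure_sum// (big_nth point) big_mkord.
by apply: eq_bigr => i _; rewrite integral_dirac// diracT mul1e.
Qed.

(** The positive and negative parts integrate to finite sums. This turns the functionals of
    [vague_subbase] into sums over [pts w]. *)
Lemma Rintegral_conf w (f : borel Y -> R) : measurable_fun setT f ->
  (\int[conf_measure w]_y f y = \sum_(x <- pts w) f x)%R.
Proof.
move=> mf; rewrite /Rintegral integralE.
have mfe : measurable_fun setT (EFin \o f) by exact/measurable_EFinP.
rewrite !ge0_integral_conf//; [|exact: measurable_funeneg|exact: measurable_funepos].
under eq_bigr do rewrite funeposE/= -EFin_max.
under [X in _ - X]eq_bigr do rewrite funenegE/= -EFin_max.
rewrite !sumEFin -EFinB/= -sumrB; apply: eq_bigr => x _.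
by have [|] := leP (f x) 0%R; have [|] := leP (- f x)%R 0%R; lra.
Qed.

End conf_facts.

(** * Vague topology *)

Lemma continuous_borel_measurable (R : realType) (T : ptopologicalType)
  (f : T -> R) : continuous f -> measurable_fun [set: borel T] (f : borel T -> R).
Proof.
move=> /continuousP cf; apply: (measurability _ (RGenOInfty.measurableE R)).
move=> /= _ [_ [a ->]] <-; rewrite setTI; apply: sub_sigma_algebra.
by apply: cf; exact: interval_open.
Qed.

(** Heine-Cantor, from the near-covering form of compactness: around x the property holds for all x'
    within r / 2 of x and all d < r / 2, and near-covering makes d independent of x. *)
Lemma compact_uniform_continuous (R : realType) (T : pseudoMetricType R)
  (h : T -> R) : compact [set: T] -> continuous h ->
  forall e, 0 < e -> exists2 d, 0 < d & forall x y, ball x d y -> `|h x - h y| < e.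
Proof.
move=> /compact_near_coveringP cT ch e e0.
have : \forall d \near (0 : R)^'+,
    [set: T] `<=` (fun x => forall y, ball x d y -> `|h x - h y| < e).
  apply: (cT R (0 : R)^'+ (fun d x => forall y, ball x d y -> `|h x - h y| < e)).
  move=> x _.
  have /cvgrPdist_lt/(_ (e / 2)) := ch x.
  rewrite divr_gt0// => /(_ isT)/nbhs_ballP[r /= r0 rP].
  have r20 : 0 < r / 2 by rewrite divr_gt0.
  exists (ball x (r / 2), [set d | d < r / 2]) => /=.
    by split; [exact: nbhsx_ballx|exact: nbhs_right_lt].
  move=> [x' d] /= [xx' dr] y x'y.
  have rx' : ball x r x' by apply: le_ball xx'; lra.
  have rxy : ball x r y.
    rewrite (splitr r); apply: ball_triangle xx' _.
    by apply: le_ball x'y; exact: ltW.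
  rewrite -(subrK (h x) (h x')) -addrA (splitr e) (le_lt_trans (ler_normD _ _))//.
  by rewrite ltrD//; [rewrite distrC|]; exact: rP.
move=> nd; have [d [/= dP d0]] := @filter_ex _ _ _ _ (filterI nd (nbhs_right_gt 0)).
by exists d => // x y; exact: dP.
Qed.

Section conf_topology.
Variables (R : realType) (Y : ptopologicalType).
Implicit Types (w : conf R Y).

(** A neighbourhood of w contains a finite intersection of subbasic sets around w, so the
    functionals of the subbase can be tested one at a time. Convergence of the signed sums implies
    that of their absolute values. *)
Lemma cvg_conf (T : Type) (FF : set_system T) (g : T -> conf R Y) w :
  Filter FF ->
  (forall f : Y -> R, continuous f ->
     \sum_(x <- pts (g t)) f x @[t --> FF] --> \sum_(x <- pts w) f x) ->
  g t @[t --> FF] --> w.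
Proof.
move=> fF gw A; rewrite nbhsE => -[_ [[B sB <-] [C BC Cw] sUBA]].
rewrite nbhs_filterE; apply: filterS sUBA _; apply: (@filterS _ _ _ C).
  by move=> ? ?; exists C.
have /sB [D sD IDeC] := BC; rewrite -IDeC; apply: filter_bigI => E DE.
have /sD := DE; rewrite inE => - [f [V [cf oV EE]]].
have mf := continuous_borel_measurable cf.
have : E w by move: Cw; rewrite -IDeC => /(_ _ DE).
rewrite {}EE /= (Rintegral_conf w mf) => Vw.
rewrite /nbhs/= /fmap/=; under eq_set do rewrite (Rintegral_conf _ mf).
have /cvg_norm := gw _ cf; apply.
exact: open_nbhs_nbhs.
Qed.

(** For f >= 0 the absolute value in [vague_subbase] disappears, and the preimage of an open set is
    itself subbasic. *)
Lemma continuous_conf_integral (f : Y -> R) : continuous f -> (forall y, 0 <= f y) ->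
  continuous (fun w : conf R Y => \sum_(x <- pts w) f x).
Proof.
move=> cf f0 w A /=; rewrite nbhsE => -[V [oV Vw] VA].
have mf := continuous_borel_measurable cf.
have If w' : `| \int[conf_measure w']_y f y | = \sum_(x <- pts w') f x.
  by rewrite (Rintegral_conf _ mf) ger0_norm// sumr_ge0.
rewrite nbhs_filterE; apply: (@filterS _ _ _ ((fun w => \sum_(x <- pts w) f x) @^-1` V)).
  exact: preimage_subset.
rewrite nbhsE; exists [set w' | V `| \int[conf_measure w']_y f y |] => [|w' /=]; last by rewrite If.
split; last by rewrite /= If.
exists [set [set w' | V `| \int[conf_measure w']_y f y |]]; last by rewrite bigcup_set1.
by move=> _ ->; apply: finI_from1; exists f, V.
Qed.

Lemma continuous_addpoint w : continuous (fun x : Y => conf_add w (conf_dirac R 1 x)).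
Proof.
move=> x; apply: cvg_conf => f cf.
have E z : \sum_(y <- pts (conf_add w (conf_dirac R 1 z))) f y = \sum_(y <- pts w) f y + f z.
  by rewrite (perm_big _ (perm_pts_add _ _)) big_cat pts_dirac /= big_seq1.
by under eq_fun do rewrite E; rewrite E; apply: cvgD; [exact: cvg_cst|exact: cf].
Qed.

(** Row vectors carry the product topology of Y^n, and [rV_compact] gives its compactness. *)
Definition conf_row n (v : 'rV[Y]_n) : conf R Y := conf_of R [seq v ord0 i | i : 'I_n].

Lemma continuous_conf_row n : continuous (@conf_row n).
Proof.
move=> v; apply: (@cvg_conf _ (nbhs v) (@conf_row n) _ (nbhs_filter v)) => f cf.
have E (u : 'rV[Y]_n) : \sum_(y <- pts (conf_row u)) f y = \sum_(i < n) f (u ord0 i).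
  by rewrite (perm_big _ (pts_conf_of _ _)) big_map big_enum.
under eq_fun do rewrite E; rewrite E.
apply: cvg_big => [|i _]; first exact: add_continuous.
move=> A /cf nA.
(* A box that constrains coordinate i alone. *)
exists (fun _ j => [set y | j = i -> A (f y)]) => [i' j|u /= uA]; last exact: (uA ord0 i).
rewrite (ord1 i'); have [->|/eqP ji] := eqVneq j i.
  by apply: (@filterS _ _ _ ((fun y => A (f y)) : set Y)) => // y /= ? _.
by apply: (@filterS _ _ _ setT) => [y _ //|]; exact: filterT.
Qed.

End conf_topology.

Section uniform_approximation.
Variables (R : realType) (Y : completePseudoMetricType R).
Hypothesis compactY : compact [set: Y].
Variable F : conf R Y -> R.
Hypothesis cF : continuous F.

Lemma conf_row_nth m (s : seq Y) : size s = m ->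
  conf_row R (\row_(i < m) nth point s i) = conf_of R s.
Proof.
move=> <-; rewrite /conf_row; congr conf_of.
rewrite -[RHS](mkseq_nth point) /mkseq -val_enum_ord -map_comp.
by apply: eq_map => i /=; rewrite mxE.
Qed.

(** Each [F \o conf_row] is uniformly continuous on the compact space Y^k; the induction takes the
    least radius over the sizes k <= n. *)
Lemma uniform_conf_of n e : 0 < e -> exists2 d, 0 < d &
  forall rho : Y -> Y, (forall y, ball (rho y) d y) ->
  forall s : seq Y, (size s <= n)%N ->
    `|F (conf_of R s) - F (conf_of R (map rho s))| < e.
Proof.
move=> e0; elim: n => [|n [d d0 dP]].
  by exists 1 => // rho _ s; rewrite leqn0 => /nilP ->; rewrite subrr normr0.
have cT : compact [set: 'rV[Y]_n.+1].
  have := @rV_compact Y n.+1 (fun _ => setT) (fun _ => compactY).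
  by congr compact; apply/seteqP; split.
have cFr : continuous (F \o @conf_row R Y n.+1).
  by move=> v; apply: continuous_comp; [exact: continuous_conf_row|exact: cF].
have [d' d'0 d'P] := compact_uniform_continuous cT cFr e0.
exists (Num.min d d') => [|rho rhoP s]; first by rewrite lt_min d0.
rewrite leq_eqVlt ltnS => /predU1P[sn|]; last first.
  by apply: dP => y; apply: le_ball (rhoP y); rewrite ge_min lexx.
rewrite distrC -(conf_row_nth sn) -(@conf_row_nth n.+1 (map rho s)) ?size_map//.
apply: d'P; split=> // i j; rewrite !mxE (nth_map point) ?sn//.
by apply: le_ball (rhoP _); rewrite ge_min lexx orbT.
Qed.

End uniform_approximation.

(** * Partitions into cells with null boundary *)

Section null_boundary_sets.
Variables (R : realType) (Y : ptopologicalType) (M : probability (borel Y) R).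
Implicit Types (A B : set Y).

(* Of a cell A, [baire_set] gives measurability of w |-> w(A) for the vague Borel
   sets, and [jordan_set] (an M-null boundary) gives M_N(A) -> M(A). *)
Definition baire_set A := exists phi : nat -> Y -> R,
  [/\ forall n, continuous (phi n), forall n y, 0 <= phi n y <= 1 &
      forall y, phi n y @[n --> \oo] --> (\1_A y : R)].

Definition jordan_set A := forall e, 0 < e -> exists fg : (Y -> R) * (Y -> R),
  [/\ continuous fg.1, continuous fg.2,
      forall y, 0 <= fg.1 y <= \1_A y, forall y, \1_A y <= fg.2 y <= 1 &
      (\int[M]_(y in [set: borel Y]) (fg.2 y - fg.1 y)%:E <= e%:E)%E].

Lemma baire_setC A : baire_set A -> baire_set (~` A).
Proof.
move=> [phi [cphi phi01 phiA]]; exists (fun n y => 1 - phi n y); split.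
- by move=> n y; apply: cvgB; [exact: cvg_cst|exact: cphi].
- by move=> n y; have := phi01 n y; lra.
- move=> y; have -> : \1_(~` A) y = 1 - \1_A y :> R.
    by rewrite !indicE in_setC; case: (y \in A); rewrite ?subrr ?subr0.
  by apply: cvgB; [exact: cvg_cst|exact: phiA].
Qed.

Lemma baire_setI A B : baire_set A -> baire_set B -> baire_set (A `&` B).
Proof.
move=> [f [cf f01 fA]] [g [cg g01 gB]]; exists (fun n y => f n y * g n y); split.
- by move=> n y; apply: cvgM; [exact: cf|exact: cg].
- move=> n y; have /andP[? ?] := f01 n y; have /andP[? ?] := g01 n y.
  by rewrite mulr_ge0//= mulr_ile1.
- by move=> y; rewrite indicI; apply: cvgM; [exact: fA|exact: gB].
Qed.

Lemma baire_set_measurable A : baire_set A -> measurable (A : set (borel Y)).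
Proof.
move=> [phi [cphi phi01 phiA]].
have mA : measurable_fun setT (\1_A : borel Y -> R).
  apply: (@measurable_fun_cvg _ (borel Y) R setT phi) => [n|y _].
    exact: continuous_borel_measurable.
  exact: phiA.
have := mA measurableT [set 1] (measurable_set1 _); rewrite setTI.
congr measurable; apply/seteqP; split=> y /=; rewrite indicE.
  by case: (boolP (y \in A)) => [/set_mem//|_ /esym/eqP]; rewrite oner_eq0.
by move=> /mem_set ->.
Qed.

(** The bracket f, g of A becomes the bracket 1 - g, 1 - f of its complement, with the same gap. *)
Lemma jordan_setC A : jordan_set A -> jordan_set (~` A).
Proof.
move=> jA e /jA[[f g] /= [cf cg fA gA fg]].
have CE y : \1_(~` A) y = 1 - \1_A y :> R.
  by rewrite !indicE in_setC; case: (y \in A); rewrite ?subrr ?subr0.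
exists (fun y => 1 - g y, fun y => 1 - f y); split => /=.
- by move=> y; apply: cvgB; [exact: cvg_cst|exact: cg].
- by move=> y; apply: cvgB; [exact: cvg_cst|exact: cf].
- by move=> y; rewrite CE; have := gA y; lra.
- by move=> y; rewrite CE; have := fA y; lra.
- by under eq_integral do rewrite opprB addrC subrKA.
Qed.

Lemma jordan_setI A B : jordan_set A -> jordan_set B -> jordan_set (A `&` B).
Proof.
move=> jA jB e e0; have e20 : 0 < e / 2 by rewrite divr_gt0.
have [[f g] /= [cf cg fA gA fg]] := jA _ e20.
have [[f' g'] /= [cf' cg' fB gB fg']] := jB _ e20.
have f01 y : 0 <= f y <= 1.
  by have := fA y; have := gA y; lra.
have fg0 y : 0 <= f y <= g y by have := fA y; have := gA y; lra.
have fg0' y : 0 <= f' y <= g' y by have := fB y; have := gB y; lra.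
have mf := continuous_borel_measurable cf.
have mg := continuous_borel_measurable cg.
have mf' := continuous_borel_measurable cf'.
have mg' := continuous_borel_measurable cg'.
exists (fun y => f y * f' y, fun y => g y * g' y); split => /=.
- by move=> y; apply: cvgM; [exact: cf|exact: cf'].
- by move=> y; apply: cvgM; [exact: cg|exact: cg'].
- move=> y; rewrite indicI; have /andP[f0 fA1] := fA y; have /andP[f0' fB1] := fB y.
  by rewrite mulr_ge0//=; apply: ler_pM.
- move=> y; rewrite indicI; have /andP[f0 fA1] := gA y; have /andP[f0' fB1] := gB y.
  have := fA y; have := fB y => fBy fAy.
  rewrite mulr_ile1//; [|lra..].
  by rewrite andbT; apply: ler_pM => //; lra.
- rewrite (splitr e) EFinD.
  apply: (le_trans _ (leeD fg fg')).
  rewrite -ge0_integralD//.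
  + apply: ge0_le_integral => //.
    * by move=> y _; rewrite lee_fin; have := fg0 y; have := fg0' y; nra.
    * by apply/measurable_EFinP; apply: measurable_funB; apply: measurable_funM.
    * by apply: emeasurable_funD; apply/measurable_EFinP; apply: measurable_funB.
    * move=> y _; rewrite -EFinD lee_fin.
      have /andP[f0 fg1] := fg0 y; have /andP[f0' fg1'] := fg0' y.
      (* The gap of the products is at most the sum of the gaps: (g - f) + (g' - f') - (g g' - f f')
         = (1 - g)(g' - f') + (1 - f')(g - f). *)
      have h1 : 0 <= (1 - g y) * (g' y - f' y).
        by apply: mulr_ge0; rewrite subr_ge0//; have := gA y; lra.
      have h2 : 0 <= (1 - f' y) * (g y - f y).
        by apply: mulr_ge0; rewrite subr_ge0//; have := gB y; lra.
      by lra.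
  + by move=> y _; rewrite lee_fin; have := fg0 y; lra.
  + by apply/measurable_EFinP; apply: measurable_funB.
  + by move=> y _; rewrite lee_fin; have := fg0' y; lra.
  + by apply/measurable_EFinP; apply: measurable_funB.
Qed.

Definition clamp (x : R) := Num.max 0 (Num.min 1 x).

Lemma clamp01 x : 0 <= clamp x <= 1.
Proof. by rewrite /clamp le_max lexx /= ge_max ler01 ge_min lexx. Qed.

Lemma clamp_id0 x : x <= 0 -> clamp x = 0.
Proof. by move=> x0; rewrite /clamp max_l// ge_min x0 orbT. Qed.

Lemma clamp_id1 x : 1 <= x -> clamp x = 1.
Proof. by move=> x1; rewrite /clamp min_l// max_r. Qed.

Lemma continuous_clamp (f : Y -> R) : continuous f ->
  continuous (fun y => clamp (f y)).
Proof.
move=> cf y; apply: (@continuous_max _ Y (cst 0) (fun y => Num.min 1 (f y)));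
  first exact: cst_continuous.
by apply: (@continuous_min _ Y (cst 1) f); [exact: cst_continuous|exact: cf].
Qed.

Lemma clamp_cvg1 (a b : R) : 0 < a -> clamp (b + n%:R * a) @[n --> \oo] --> (1 : R).
Proof.
move=> a0; apply: cvg_near_cst; near=> n; apply: clamp_id1.
rewrite -lerBlDl -ler_pdivrMr//; near: n; exact: nbhs_infty_ger.
Unshelve. all: by end_near. Qed.

Lemma clamp_cvg0 (a b : R) : a < 0 -> clamp (b + n%:R * a) @[n --> \oo] --> (0 : R).
Proof.
move=> a0; apply: cvg_near_cst; near=> n; apply: clamp_id0.
suff : b / - a <= n%:R by rewrite ler_pdivrMr ?oppr_gt0// mulrN; lra.
near: n; exact: nbhs_infty_ger.
Unshelve. all: by end_near. Qed.

Lemma continuous_slope (f : Y -> R) (n : nat) (b t : R) : continuous f ->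
  continuous (fun y => clamp (b + n%:R * (t - f y))).
Proof.
move=> cf; apply: continuous_clamp => y; apply: cvgD; first exact: cvg_cst.
apply: cvgM; first exact: cvg_cst.
by apply: cvgB; [exact: cvg_cst|exact: cf].
Qed.

Lemma slope_cvg (f : Y -> R) t y :
  clamp (0 + n%:R * (t - f y)) @[n --> \oo] --> (\1_[set y | f y < t] y : R).
Proof.
rewrite indicE; have [fy|tf] := ltP (f y) t.
  by rewrite mem_set//=; apply: clamp_cvg1; rewrite subr_gt0.
rewrite memNset /=; last by apply/negP; rewrite -leNgt.
move: tf; rewrite le_eqVlt => /predU1P[->|tf]; last by apply: clamp_cvg0; rewrite subr_lt0.
under eq_fun do rewrite subrr mulr0 addr0 clamp_id0//.
exact: cvg_cst.
Qed.

Lemma baire_set_lt (f : Y -> R) t : continuous f -> baire_set [set y | f y < t].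
Proof.
move=> cf; exists (fun n y => clamp (0 + n%:R * (t - f y))); split.
- by move=> n; exact: continuous_slope.
- by move=> n y; exact: clamp01.
- by move=> y; exact: slope_cvg.
Qed.

(** The ramps u_n lie below the indicator of f < t and converge to it; the ramps v_n, started at
    height 1 on the level f = t, lie above it and converge to the indicator of f <= t. Their
    difference tends to the indicator of f = t, which is M-null, so its integral vanishes by
    dominated convergence. *)
Lemma jordan_set_lt (f : Y -> R) t : continuous f ->
  M ([set y | f y = t] : set (borel Y)) = 0%E -> jordan_set [set y | f y < t].
Proof.
move=> cf Mt0 e e0.
pose u (n : nat) y := clamp (0 + n%:R * (t - f y)).
pose v (n : nat) y := clamp (1 + n%:R * (t - f y)).
have cu n : continuous (u n) by exact: continuous_slope.
have cv n : continuous (v n) by exact: continuous_slope.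
have mf := continuous_borel_measurable cf.
have mt : measurable ([set y | f y = t] : set (borel Y)).
  by have := mf measurableT [set t] (measurable_set1 _); rewrite setTI.
have uA n y : 0 <= u n y <= \1_[set y | f y < t] y.
  have /andP[-> u1] /= := clamp01 (0 + n%:R * (t - f y)).
  rewrite indicE; case: (boolP (y \in _)) => //; rewrite notin_setE /= => /negP.
  by rewrite -leNgt /u => tf; rewrite clamp_id0// add0r mulr_ge0_le0//; lra.
have vA n y : \1_[set y | f y < t] y <= v n y <= 1.
  have /andP[v0 ->] /= := clamp01 (1 + n%:R * (t - f y)).
  rewrite andbT indicE; case: (boolP (y \in _)) => //; rewrite inE /= => ft.
  by rewrite /v clamp_id1// lerDl mulr_ge0// subr_ge0 ltW.
have : (\int[M]_(y in [set: borel Y]) (v n y - u n y)%:E @[n --> \oo] --> 0)%E.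
  have -> : 0%E = (\int[M]_(y in [set: borel Y]) (\1_[set y | f y = t] y)%:E)%E.
    by rewrite integral_indic// setIT.
  have [] // := @dominated_convergence _ _ _ M setT measurableT
    (fun n y => (v n y - u n y)%:E) (fun y => (\1_[set y | f y = t] y)%:E) (cst 1%E).
  - move=> n; apply/measurable_EFinP; apply: measurable_funB;
      exact: continuous_borel_measurable.
  - by apply/measurable_EFinP; exact: measurable_indic.
  - apply: aeW => y _; apply: cvg_EFin; first exact: nearW.
    rewrite indicE; have [ft|tf|ft] := ltgtP (f y) t.
    + rewrite memNset/=; last by move=> ft'; move: ft; rewrite ft' ltxx.
      rewrite [X in _ --> X](_ : _ = 1 - 1); last by rewrite subrr.
      by apply: cvgB; apply: clamp_cvg1; rewrite subr_gt0.
    + rewrite memNset/=; last by move=> ft'; move: tf; rewrite ft' ltxx.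
      rewrite [X in _ --> X](_ : _ = 0 - 0); last by rewrite subrr.
      by apply: cvgB; apply: clamp_cvg0; rewrite subr_lt0.
    + rewrite mem_set//=; apply: cvg_near_cst; apply: nearW => n.
      rewrite /=; have -> : u n y = 0 by rewrite /u ft (subrr t) mulr0 addr0 clamp_id0.
      have -> : v n y = 1 by rewrite /v ft (subrr t) mulr0 addr0 clamp_id1.
      by rewrite subr0.
  - exact: finite_measure_integrable_cst.
  - apply: aeW => y n _; rewrite lee_fin.
    by have := uA n y; have := vA n y; rewrite ler_norml; lra.
move=> /fine_cvgP[_ /cvgrPdist_lt/(_ _ e0)[n _ /(_ n (leqnn n))]] /=.
rewrite sub0r normrN => ne.
exists (u n, v n); split => //=.
have I0 : (0 <= \int[M]_(y in [set: borel Y]) (v n y - u n y)%:E)%E.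
  apply: integral_ge0 => y _; rewrite lee_fin.
  by have := uA n y; have := vA n y; lra.
have Ifin : (\int[M]_(y in [set: borel Y]) (v n y - u n y)%:E \is a fin_num)%E.
  rewrite ge0_fin_numE//; apply: (@le_lt_trans _ _ (\int[M]_(y in [set: borel Y]) cst 1 y)%E).
    apply: ge0_le_integral => //.
    + by move=> y _; rewrite lee_fin; have := uA n y; have := vA n y; lra.
    + by apply/measurable_EFinP; apply: measurable_funB;
        exact: continuous_borel_measurable.
    + by move=> y _ /=; rewrite lee_fin; have := uA n y; have := vA n y; lra.
  rewrite integral_cst// mul1e; exact: (le_lt_trans (probability_le1 M measurableT) (ltry _)).
by rewrite -(fineK Ifin) lee_fin ltW// (le_lt_trans (ler_norm _)).
Qed.

(** The levels charged by M are the atoms of the law of f under M. They are countable, hence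
    Lebesgue-null, and cannot fill an interval. *)
Lemma exists_null_level (f : Y -> R) a b : continuous f -> a < b ->
  exists2 t, a < t < b & M ([set y | f y = t] : set (borel Y)) = 0%E.
Proof.
move=> cf ab; apply: contrapT => nt.
have mf : measurable_fun setT (f : borel Y -> R) by exact: continuous_borel_measurable.
pose X : {mfun borel Y >-> R} := HB.pack (f : borel Y -> R) (isMeasurableFun.Build _ _ _ _ _ mf).
have cX := @pmf_gt0_countable _ _ _ M X.
have lm0 := countable_lebesgue_measure0 cX.
suff : (0 < lebesgue_measure [set r | (0 < @pmf _ _ _ M X r)%R])%E by rewrite lm0 ltxx.
apply: (@lt_le_trans _ _ (lebesgue_measure (`]a, b[%classic : set R))).
  by rewrite lebesgue_measure_itv /= lte_fin ab lte_fin subr_gt0.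
apply: le_measure.
- by rewrite inE; exact: measurable_itv.
- by rewrite inE; exact: countable_measurable.
- move=> t /=; rewrite in_itv /= => tab.
  rewrite lt0r pmf_ge0 andbT; apply/eqP => pmf0; apply: nt; exists t => //.
  have mt : measurable ([set y | f y = t] : set (borel Y)).
    by have := mf measurableT [set t] (measurable_set1 _); rewrite setTI.
  by rewrite -[LHS](@fineK _ (M _)) ?fin_num_measure//; congr EFin.
Qed.

End null_boundary_sets.

Section null_boundary_partition.
Variables (R : realType) (Y : completePseudoMetricType R).
Variable M : probability (borel Y) R.

Definition good_set (A : set Y) := baire_set R A /\ jordan_set M A.

Lemma good_setC A : good_set A -> good_set (~` A).
Proof. by move=> [? ?]; split; [exact: baire_setC|exact: jordan_setC]. Qed.

Lemma good_setI A B : good_set A -> good_set B -> good_set (A `&` B).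
Proof. by move=> [? ?] [? ?]; split; [exact: baire_setI|exact: jordan_setI]. Qed.

Lemma good_setT : good_set setT.
Proof.
split.
  exists (fun _ => cst 1); split => [n|n y|y].
  - exact: cst_continuous.
  - by rewrite /= ler01 lexx.
  - by rewrite indicT; exact: cvg_cst.
move=> e e0; exists (cst 1, cst 1); split => /=; [exact: cst_continuous..| | |].
- by move=> y; rewrite indicT /= ler01 lexx.
- by move=> y; rewrite indicT /= lexx.
- by under eq_integral do rewrite subrr; rewrite integral0 lee_fin ltW.
Qed.

(** Making a cover disjoint by the first set that contains y uses only complements and
    intersections, which preserve good sets. *)
Lemma good_set_find (s : seq (set Y)) i : {in s, forall B, good_set B} ->
  good_set [set y | find (fun B : set Y => y \in B) s = i].
Proof.
elim: s i => [|B s ih] i gs /=.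
  case: i => [|i].
    by rewrite (_ : mkset _ = setT); [exact: good_setT|apply/seteqP; split].
  rewrite (_ : mkset _ = ~` setT); first exact/good_setC/good_setT.
  by apply/seteqP; split => y //=; apply.
have gB : good_set B by apply: gs; rewrite mem_head.
have gs' : {in s, forall B, good_set B}.
  by move=> C Cs; apply: gs; rewrite in_cons Cs orbT.
case: i => [|i].
  rewrite (_ : mkset _ = B)//; apply/seteqP; split => y /=.
    by case: ifPn => // /set_mem.
  by move=> /mem_set ->.
rewrite (_ : mkset _ = ~` B `&` [set y | find (fun B : set Y => y \in B) s = i]).
  by apply: good_setI; [exact: good_setC|exact: ih].
apply/seteqP; split => y /=.
  by case: ifPn => // /negP yB [->]; split => // /mem_set.
by move=> [yB ->]; rewrite memNset.
Qed.

Hypotheses (hausY : hausdorff_space Y) (compactY : compact [set: Y]).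

(** A compact Hausdorff space is normal, so some continuous f is 0 at y and 1 off the interior of
    the ball. Any M-null level t in ]0, 1[ gives the sublevel set f < t. *)
Lemma good_open_nbhs (y : Y) d : 0 < d -> exists B : set Y,
  [/\ open B, B y, B `<=` ball y d & good_set B].
Proof.
move=> d0.
have sep : uniform_separator [set y] (~` (ball y d)^°).
  have /normal_separatorP nsep := compact_normal hausY compactY.
  apply: (nsep R).
  - exact: accessible_closed_set1 (hausdorff_accessible hausY) _.
  - exact: open_closedC (open_interior _).
  - apply/seteqP; split => // z [/= -> ]; apply.
    by rewrite /interior; exact: nbhsx_ballx.
have [f [cf f01 f0 f1]] := (@uniform_separatorP _ R _ _).1 sep.
have [t /andP[t0 t1] Mt] := exists_null_level M cf ltr01.
exists [set z | f z < t]; split.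
- by apply: (@open_comp _ _ f [set r | r < t]) => [z _|]; [exact: cf|exact: open_lt].
- by rewrite /= (f0 (f y))//; exists y.
- move=> z /= fz; apply: interior_subset; apply: contrapT => nz.
  by move: fz; rewrite (f1 (f z)) ?ltNge ?(ltW t1)//; exists z.
- by split; [exact: baire_set_lt|exact: jordan_set_lt].
Qed.

Lemma good_partition d : 0 < d ->
  exists (r : nat) (iota : Y -> 'I_r) (a : 'I_r -> Y),
    (forall y, ball (a (iota y)) d y) /\ (forall i, good_set (iota @^-1` [set i])).
Proof.
move=> d0.
have /choice[B BP] := fun y => good_open_nbhs y d0.
move: compactY; rewrite compact_cover => /(_ _ setT B)[|y _|D _ Dcover].
- by move=> y _; have [] := BP y.
- by exists y => //; have [] := BP y.
pose s := map B D; pose fd y := find (fun C : set Y => y \in C) s.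
have fds y : (fd y < size s)%N.
  rewrite /fd -has_find; have [//|z Dz Bzy] := Dcover y.
  by apply/hasP; exists (B z); [exact: map_f|exact: mem_set].
(* The successor makes the index type inhabited, as [inord] requires; the last cell is empty. The
   reference point of a cell is the centre of the neighbourhood it was cut from. *)
exists (size s).+1, (fun y => inord (fd y)), (fun i => nth point (D : seq Y) i).
have fdE y : (inord (fd y) : 'I_(size s).+1) = fd y :> nat.
  by rewrite inordK// ltnS ltnW.
split => [y|i].
  have := fds y; rewrite fdE {1}/s size_map => yD.
  have [_ _ + _] := BP (nth point (D : seq Y) (fd y)); apply.
  have := @nth_find _ set0 (fun C : set Y => y \in C) s.
  by rewrite has_find fds (nth_map point)// => /(_ isT)/set_mem.
have gs : {in s, forall C, good_set C}.
  by move=> C /mapP[z _ ->]; have [] := BP z.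
have := good_set_find i gs; congr good_set; apply/seteqP; split => y /=.
  by move=> fi; apply/val_inj; rewrite /= fdE.
by move=> <-; rewrite fdE.
Qed.

End null_boundary_partition.

(** The sums of phi_n over [pts w] are vaguely continuous since phi_n >= 0, and for fixed w they are
    finite sums that converge to w(A). *)
Lemma measurable_cnt (R : realType) (Y : ptopologicalType) (A : set Y) :
  baire_set R A ->
  measurable_fun [set: borel (conf R Y)] (fun w : borel (conf R Y) => (cnt A (w : conf R Y))%:R : R).
Proof.
move=> [phi [cphi phi01 phiA]].
apply: (@measurable_fun_cvg _ (borel (conf R Y)) R setT
  (fun n (w : borel (conf R Y)) => \sum_(x <- pts (w : conf R Y)) phi n x)) => [n|w _].
  apply: continuous_borel_measurable; apply: continuous_conf_integral => //.
  by move=> y; have /andP[] := phi01 n y.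
have -> : (cnt A (w : conf R Y))%:R = \sum_(x <- pts (w : conf R Y)) (\1_A x : R).
  rewrite /cnt; elim: (pts _) => [|x s ih]; first by rewrite big_nil.
  by rewrite big_cons /= natrD ih indicE.
by apply: cvg_big => [|x _]; [exact: add_continuous|exact: phiA].
Qed.

(** * Countably valued random variables *)

Section countable_law.
Context d (T : measurableType d) (R : realType) (Pr : probability T R).
Variables (C : countType) (V : T -> C).
Hypothesis mV : forall c, measurable (V @^-1` [set c]).

Lemma countable_preimage_measurable (A : set C) : measurable (V @^-1` A).
Proof.
rewrite (_ : V @^-1` A = \bigcup_n
    (if pickle_inv n is Some c then
       (if c \in A then V @^-1` [set c] else set0) else set0)).
  apply: bigcupT_measurable => n; case: pickle_inv => // c.
  by case: ifP => // _; exact: mV.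
apply/seteqP; split => [w /= Aw|w [n _] /=].
  by exists (@choice.pickle C (V w)) => //; rewrite pickleK_inv mem_set.
by case: pickle_inv => // c; case: ifP => // /set_mem ? ->.
Qed.

Lemma countable_measurable_fun d' (T' : measurableType d') (f : C -> T') :
  measurable_fun setT (f \o V).
Proof.
by move=> _ B mB; rewrite setTI comp_preimage; exact: countable_preimage_measurable.
Qed.

Local Open Scope ereal_scope.

Lemma countable_measurable_fine (f : C -> R) :
  measurable_fun setT (fun w => (f (V w))%:E).
Proof. exact: (countable_measurable_fun (fun c => (f c)%:E)). Qed.

Lemma integral_countable (f : C -> \bar R) : (forall c, 0 <= f c) ->
  \int[Pr]_w f (V w) = \esum_(c in setT) (f c * Pr (V @^-1` [set c])).
Proof.
move=> f0.
(* The events V = c, numbered by the codes of c, form a countable partition; integers that code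
   nothing get the empty event. *)
pose G n := if pickle_inv n is Some c then V @^-1` [set c] else set0.
have GT : \bigcup_n G n = setT.
  apply/seteqP; split => // w _; exists (@choice.pickle C (V w)) => //.
  by rewrite /G pickleK_inv.
have mG n : measurable (G n).
  by rewrite /G; case: pickle_inv => // c; exact: mV.
have tG : trivIset setT G.
  apply/trivIsetP => i j _ _ ij; apply/seteqP; split => // w [].
  rewrite /G; have := @pickle_invK C i; have := @pickle_invK C j.
  case: (pickle_inv i) => // c; case: (pickle_inv j) => // c' /= e e' Vc Vc'.
  by move: ij; rewrite -e -e' -Vc -Vc' eqxx.
rewrite -GT ge0_integral_bigcup//; [|rewrite GT; exact: (countable_measurable_fun f)].
have -> : \sum_(0 <= i <oo) \int[Pr]_(x in G i) f (V x) =
  \sum_(0 <= i <oo) (if pickle_inv i is Some c then f c * Pr (V @^-1` [set c]) else 0).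
  apply: eq_eseriesr => n _; rewrite /G; case: pickle_inv => [c|]; last by rewrite integral_set0.
  rewrite (eq_integral (cst (f c))); last first.
    move=> w /set_mem Vw. by rewrite /cst -Vw.
  by rewrite integral_cst.
rewrite nneseries_esumT; last first.
  by move=> n; case: pickle_inv => // c; rewrite mule_ge0.
transitivity (\esum_(n in range (@choice.pickle C))
    (if pickle_inv n is Some c then f c * Pr (V @^-1` [set c]) else 0)).
  rewrite [RHS]esum_mkcond; apply: eq_esum => n _; case: ifPn => // nr.
  have := @pickle_invK C n; case: pickle_inv => // c /= cn.
  by case/negP: nr; rewrite inE; exists c.
rewrite (reindex_esum setT _ (@choice.pickle C)).
  by apply: eq_esum => c _; rewrite pickleK_inv.
split.
- by move=> c _; exists c.
- by move=> c c' _ _; exact: (pcan_inj (@choice.pickleK C)).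
- by [].
Qed.

End countable_law.

Section convergence_in_law.
Context d (T : measurableType d) (R : realType) (Pr : probability T R).
Variables (C : countType) (V : T -> C).
Hypothesis mV : forall c, measurable (V @^-1` [set c]).

Context d' (T_ : nat -> measurableType d') (Pr_ : forall n, probability (T_ n) R).
Variable V_ : forall n, T_ n -> C.
Hypothesis mV_ : forall n c, measurable (@V_ n @^-1` [set c]).
Hypothesis cvgV : forall c,
  fine (Pr_ n (@V_ n @^-1` [set c])) @[n --> \oo] --> fine (Pr (V @^-1` [set c])).

Lemma integral_fin_num01 d0 (T0 : measurableType d0) (P0 : probability T0 R)
  (f : T0 -> R) : measurable_fun setT f -> (forall x, 0 <= f x <= 1) ->
  (\int[P0]_x (f x)%:E \is a fin_num)%E.
Proof.
move=> mf f01; rewrite ge0_fin_numE; last first.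
  by apply: integral_ge0 => x _; rewrite lee_fin; have /andP[] := f01 x.
apply: (@le_lt_trans _ _ (\int[P0]_x cst 1 x)%E).
  apply: ge0_le_integral => //.
  - by move=> x _; rewrite lee_fin; have /andP[] := f01 x.
  - exact/measurable_EFinP.
  - by move=> x _ /=; rewrite lee_fin; have /andP[] := f01 x.
rewrite integral_cst// mul1e.
by apply: le_lt_trans (probability_le1 P0 measurableT) (ltry _).
Qed.

Lemma integral_onem d0 (T0 : measurableType d0) (P0 : probability T0 R)
  (f : T0 -> R) : measurable_fun setT f -> (forall x, 0 <= f x <= 1) ->
  (fine (\int[P0]_x (1 - f x)%:E) = 1 - fine (\int[P0]_x (f x)%:E))%R.
Proof.
move=> mf f01.
have f'01 x : 0 <= 1 - f x <= 1 by have := f01 x; lra.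
have mf' : measurable_fun setT (fun x => 1 - f x) by exact: measurable_funB.
apply/eqP; rewrite -subr_eq opprK -fineD ?integral_fin_num01//.
rewrite -ge0_integralD//; first last.
- exact/measurable_EFinP.
- by move=> x _; rewrite lee_fin; have /andP[] := f01 x.
- exact/measurable_EFinP.
- by move=> x _; rewrite lee_fin; have /andP[] := f'01 x.
under eq_integral do rewrite -EFinD subrK.
by rewrite integral_cst//= mul1e probability_setT.
Qed.

(** Finitely many values of V already contribute more than I - e. Their masses converge, and the
    remaining values can only add because f >= 0. *)
Let lower (f : C -> R) e : (forall c, 0 <= f c <= 1) -> 0 < e ->
  \forall n \near \oo,
    fine (\int[Pr]_w (f (V w))%:E) - e < fine (\int[Pr_ n]_w (f (@V_ n w))%:E).
Proof.
move=> f01 e0.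
have f0 c : (0 <= (f c)%:E)%E by rewrite lee_fin; have /andP[] := f01 c.
set I := fine _.
have : ((I - e)%:E < \esum_(c in setT) ((f c)%:E * Pr (V @^-1` [set c])))%E.
  rewrite -(integral_countable Pr mV f0) -[ltRHS]fineK; last first.
    apply: integral_fin_num01 => //.
    exact: (countable_measurable_fun mV f).
  by rewrite lte_fin -/I ltrBlDr ltrDl.
move=> /ereal_sup_gt[_ [A [finA _] <-]].
rewrite fsbig_finite//=.
pose s := enum_fset (fset_set A).
have sumE d0 (T0 : measurableType d0) (P0 : probability T0 R) (V0 : T0 -> C) :
    (forall c, measurable (V0 @^-1` [set c])) ->
    (\sum_(c <- s) ((f c)%:E * P0 (V0 @^-1` [set c])) =
     (\sum_(c <- s) f c * fine (P0 (V0 @^-1` [set c])))%:E)%E.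
  move=> mV0; rewrite -sumEFin; apply: eq_bigr => c _.
  by rewrite EFinM fineK// fin_num_measure.
rewrite sumE// lte_fin => Is.
have : \sum_(c <- s) f c * fine (Pr_ n (@V_ n @^-1` [set c])) @[n --> \oo]
    --> \sum_(c <- s) f c * fine (Pr (V @^-1` [set c])).
  apply: cvg_big => [|c _]; first exact: add_continuous.
  by apply: cvgM; [exact: cvg_cst|exact: cvgV].
move=> /(cvgr_gt _)/(_ _ Is); apply: filterS => n /lt_le_trans; apply.
rewrite -lee_fin fineK; last first.
  apply: integral_fin_num01 => //; exact: (countable_measurable_fun (mV_ n) f).
rewrite (integral_countable (Pr_ n) (mV_ n) f0) -sumE//.
apply: esum_ge; exists A; first by split.
by rewrite fsbig_finite.
Qed.

(** All laws have total mass 1, so the lower bound for 1 - f is the upper bound for f. This replaces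
    a tightness argument. *)
Lemma countable_cvg_integral (f : C -> R) : (forall c, 0 <= f c <= 1) ->
  fine (\int[Pr_ n]_w (f (@V_ n w))%:E) @[n --> \oo] -->
  fine (\int[Pr]_w (f (V w))%:E).
Proof.
move=> f01; apply/cvgrPdist_lt => e e0.
have f'01 c : 0 <= 1 - f c <= 1 by have := f01 c; lra.
have := lower f'01 e0; have := lower f01 e0.
apply: filterS2 => n.
have E := @integral_onem _ _ Pr (f \o V) (countable_measurable_fun mV f) (fun w => f01 (V w)).
have E_ := @integral_onem _ _ (Pr_ n) (f \o @V_ n) (countable_measurable_fun (mV_ n) f)
  (fun w => f01 (V_ w)).
by rewrite {}E {}E_ /= ltr_norml; lra.
Qed.

End convergence_in_law.

(** * Vectors of independent Poisson variables *)

Section poisson_vectors.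
Variable R : realType.

(** At rate 0 the law is the Dirac mass at 0, and the formula still holds because 0 ^+ 0 = 1. *)
Lemma poisson_lawE (q : R) n : 0 <= q ->
  poisson_law q n = q ^+ n / n`!%:R * expR (- q).
Proof.
rewrite /poisson_law /poisson_prob le_eqVlt => /predU1P[<-|q0].
  rewrite ltxx diracE oppr0 expR0 mulr1; case: n => [|n].
    by rewrite mem_set// expr0 fact0 divr1.
  by rewrite memNset// expr0n mul0r.
rewrite q0 esum_set1 ?lee_fin ?poisson_pmf_ge0//= /poisson_pmf q0.
by rewrite mulrAC.
Qed.

Lemma poisson_law_ge0 (q : R) n : 0 <= q -> 0 <= poisson_law q n.
Proof.
by move=> q0; rewrite poisson_lawE// !mulr_ge0 ?invr_ge0 ?exprn_ge0 ?expR_ge0.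
Qed.

Lemma poisson_lawS (q : R) n : 0 <= q ->
  n.+1%:R * poisson_law q n.+1 = q * poisson_law q n.
Proof.
move=> q0; rewrite !poisson_lawE// exprS factS natrM.
have n0 : n`!%:R != 0 :> R by rewrite pnatr_eq0 -lt0n fact_gt0.
have m0 : n.+1%:R != 0 :> R by rewrite pnatr_eq0.
by move: n.+1%:R m0 => m m0; field; rewrite n0.
Qed.

Section vector.
Variable (N : nat).
Implicit Types (p : 'I_N -> R) (c : {ffun 'I_N -> nat}) (k : 'I_N).

Definition poisson_vec p c := \prod_(k < N) poisson_law (p k) (c k).

Definition incr k c : {ffun 'I_N -> nat} := [ffun j => (c j + (j == k))%N].

Lemma incr_inj k : injective (incr k).
Proof.
by move=> c c' /ffunP e; apply/ffunP => j; have := e j; rewrite !ffunE => /addIn.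
Qed.

Lemma incr_pos k c : (0 < c k)%N -> exists c', c = incr k c'.
Proof.
move=> ck; exists [ffun j => (c j - (j == k))%N]; apply/ffunP => j.
by rewrite !ffunE subnK//; case: eqP => // ->.
Qed.

Lemma poisson_vec_incr p k c : (forall j, 0 <= p j) ->
  (c k).+1%:R * poisson_vec p (incr k c) = p k * poisson_vec p c.
Proof.
move=> p0; rewrite /poisson_vec (bigD1 k)//= [in RHS](bigD1 k)//=.
rewrite !mulrA !ffunE eqxx addn1 poisson_lawS//; congr (_ * _).
by apply: eq_bigr => j /negbTE jk; rewrite ffunE jk addn0.
Qed.

(** Independence and the Poisson marginals are both contained in the product form of the mass
    function. *)
Definition is_poisson_vec d (T : measurableType d) (Pr : probability T R)
    (V : T -> {ffun 'I_N -> nat}) p :=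
  (forall c, measurable (V @^-1` [set c])) /\
  (forall c, Pr (V @^-1` [set c]) = (poisson_vec p c)%:E).

Section mecke.
Context d (T : measurableType d) (Pr : probability T R).
Variables (V : T -> {ffun 'I_N -> nat}) (p : 'I_N -> R).
Hypotheses (p0 : forall k, 0 <= p k) (PV : is_poisson_vec Pr V p).
Local Open Scope ereal_scope.

(** Vectors with c_k = 0 contribute nothing on the left; every other vector is c' + e_k for a unique
    c', and [poisson_vec_incr] exchanges the weight c_k for p_k. *)
Lemma mecke k (h : {ffun 'I_N -> nat} -> \bar R) : (forall c, 0 <= h c) ->
  \int[Pr]_w ((V w k)%:R%:E * h (V w)) = (p k)%:E * \int[Pr]_w h (incr k (V w)).
Proof.
move=> h0; have [mV lawV] := PV.
have mh : measurable_fun setT (fun w => h (incr k (V w))).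
  exact: (countable_measurable_fun mV (fun c => h (incr k c))).
rewrite -ge0_integralZl_EFin//.
rewrite (integral_countable Pr mV (f := fun c => (c k)%:R%:E * h c)); last first.
  by move=> c; rewrite mule_ge0.
rewrite (integral_countable Pr mV (f := fun c => (p k)%:E * h (incr k c))); last first.
  by move=> c; rewrite mule_ge0// lee_fin.
transitivity (\esum_(c in range (incr k)) ((c k)%:R%:E * h c * Pr (V @^-1` [set c]))).
  rewrite [RHS]esum_mkcond; apply: eq_esum => c _; case: ifPn => // nr.
  have [->|ck] := posnP (c k); first by rewrite !mul0e.
  have [c' cc'] := incr_pos ck.
  by case/negP: nr; rewrite inE; exists c'.
rewrite (reindex_esum setT _ (incr k)); last first.
  split; [by move=> c _; exists c|by move=> c c' _ _; exact: incr_inj|by []].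
apply: eq_esum => c _; rewrite !lawV muleAC -EFinM.
rewrite ffunE eqxx addn1 poisson_vec_incr// EFinM.
by rewrite -!muleA; congr (_ * _); rewrite muleC.
Qed.

End mecke.
End vector.

Section grouping.
Variables (N r : nat) (i : 'I_N -> 'I_r).

Definition group_counts (c : {ffun 'I_N -> nat}) : {ffun 'I_r -> nat} :=
  [ffun j => (\sum_(k < N | i k == j) c k)%N].

Lemma group_counts_incr k c : group_counts (incr k c) = incr (i k) (group_counts c).
Proof.
apply/ffunP => j; rewrite !ffunE.
under eq_bigr do rewrite ffunE.
rewrite big_split /=; congr addn; rewrite -big_mkcondr sum1dep_card /=.
have [->|jk] := eqVneq j (i k).
  rewrite (_ : finset _ = [set k]%SET) ?cards1//; apply/setP => l.
  by rewrite !inE; case: (l =P k) => [->|]; rewrite ?eqxx ?andbF.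
apply: eq_card0 => l; rewrite !inE; case: (l =P k) => [->|]; rewrite ?andbF//.
by rewrite eq_sym (negbTE jk).
Qed.

Context d (T : measurableType d) (Pr : probability T R).
Variables (V : T -> {ffun 'I_N -> nat}) (p : 'I_N -> R).
Hypotheses (p0 : forall k, 0 <= p k) (PV : is_poisson_vec Pr V p).

Definition group_rates (j : 'I_r) := \sum_(k < N | i k == j) p k.

(* Both laws satisfy the Mecke recursion (c_j + 1) P(c + e_j) = q_j P(c). *)
Lemma poisson_vec_group : is_poisson_vec Pr (group_counts \o V) group_rates.
Proof.
have [mV lawV] := PV.
have mG (c : {ffun 'I_r -> nat}) : measurable ((group_counts \o V) @^-1` [set c]).
  by rewrite comp_preimage; exact: countable_preimage_measurable.
have q0 j : 0 <= group_rates j by exact: sumr_ge0.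
split => // c.
have [n] := ubnP (\sum_(j < r) c j)%N.
elim: n c => // n ih c; rewrite ltnS => cn.
have [/existsP[j cj]|] := boolP [exists j, (0 < c j)%N]; last first.
  move=> /existsPn c0.
  have {}c0 j : c j = 0%N by have := c0 j; rewrite lt0n negbK => /eqP.
  (* All groups are empty exactly when V = 0, and both sides are then exp(- sum_k p_k). *)
  rewrite (_ : _ @^-1` _ = V @^-1` [set [ffun=> 0%N]]).
    rewrite lawV /poisson_vec; congr EFin.
    transitivity (\prod_(k < N) expR (- p k)).
      by apply: eq_bigr => k _; rewrite ffunE poisson_lawE// expr0 divr1 mul1r.
    transitivity (\prod_(j < r) expR (- group_rates j)).
      rewrite -!expR_sum !sumrN; congr (expR (- _)).
      by rewrite (partition_big i predT).
    by apply: eq_bigr => j _; rewrite c0 poisson_lawE// expr0 divr1 mul1r.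
  apply/seteqP; split => w /=; last first.
    by move=> ->; apply/ffunP => j; rewrite ffunE c0 big1// => k _; rewrite ffunE.
  move=> /ffunP e; apply/ffunP => k; rewrite ffunE.
  have := e (i k); rewrite c0 ffunE => /eqP.
  by rewrite sum_nat_eq0 => /forall_inP/(_ k (eqxx _))/eqP.
have [c' cc'] := incr_pos cj.
have c'n : (\sum_(j < r) c' j < n)%N.
  apply: leq_trans cn; rewrite cc' (bigD1 j)//= [in ltnRHS](bigD1 j)//= ffunE eqxx addn1.
  by rewrite addSn ltnS leq_add2l; apply: leq_sum => l _; rewrite ffunE leq_addr.
pose ind (c : {ffun 'I_r -> nat}) (v : {ffun 'I_N -> nat}) : \bar R :=
  (\1_[set u | group_counts u = c] v)%:E.
have ind0 c0 v : (0 <= ind c0 v)%E by rewrite lee_fin.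
have indE c0 : (\int[Pr]_w ind c0 (V w) = Pr ((group_counts \o V) @^-1` [set c0]))%E.
  transitivity (\int[Pr]_w (\1_((group_counts \o V) @^-1` [set c0]) w)%:E)%E.
    by apply: eq_integral => w _; rewrite /ind !indicE.
  by rewrite integral_indic// setIT.
(* On the event that the grouped vector is c, the sum of V_k over group j equals c_j = c'_j + 1.
   Applying [mecke] to each such k turns c into c', because an increment at k is an increment of
   group j. *)
have key : ((c' j).+1%:R%:E * Pr ((group_counts \o V) @^-1` [set c]) =
            (group_rates j)%:E * Pr ((group_counts \o V) @^-1` [set c']))%E.
  rewrite -!indE.
  transitivity (\sum_(k < N | i k == j) \int[Pr]_w ((V w k)%:R%:E * ind c (V w)))%E.
    rewrite -[RHS]big_filter -ge0_integral_sum//; last 2 first.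
    - by move=> k; exact: (countable_measurable_fun mV (fun u => (u k)%:R%:E * ind c u)%E).
    - by move=> k w _; rewrite mule_ge0.
    have mi : measurable_fun setT (ind c \o V) by exact: (countable_measurable_fun mV (ind c)).
    rewrite -ge0_integralZl_EFin//.
    apply: eq_integral => w _; rewrite big_filter.
    rewrite -ge0_sume_distrl; last by move=> k _; rewrite lee_fin.
    rewrite /ind indicE; case: (boolP (_ \in _)) => [/set_mem /= e|_]; last by rewrite !mule0.
    rewrite !mule1 sumEFin; congr EFin; rewrite -natr_sum; congr _%:R.
    have := congr1 (fun u : {ffun 'I_r -> nat} => u j) e; rewrite ffunE => ->.
    by rewrite cc' ffunE eqxx addn1.
  rewrite /group_rates -sumEFin ge0_sume_distrl//; last by move=> k _; rewrite lee_fin.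
  apply: eq_bigr => k /eqP ikj; rewrite (mecke p0 PV)//; congr (_ * _)%E.
  apply: eq_integral => w _; rewrite /ind !indicE; congr (_%:R%:E).
  congr nat_of_bool; apply/idP/idP; rewrite !inE /= group_counts_incr ikj cc'.
    exact: incr_inj.
  by move=> ->.
have ne0 : (c' j).+1%:R != 0 :> R by rewrite pnatr_eq0.
rewrite (ih _ c'n) -EFinM -poisson_vec_incr// -cc' EFinM in key.
move/(congr1 (fun x => ((c' j).+1%:R^-1)%:E * x)%E): key.
by rewrite !muleA -EFinM mulVf// !mul1e.
Qed.

End grouping.
End poisson_vectors.

(** * The image form and single jumps *)

Section one_coordinate.
Variable R : realType.

Lemma dist_TV_add (Y : ptopologicalType) (w : conf R Y) n x :
  dist_TV (conf_add w (conf_dirac R n x)) w = n%:R.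
Proof.
rewrite /dist_TV -(@fsbig_widen _ _ _ _ [set x])//.
  by rewrite fsbig_set1 msetE2 msetnxx natrD addrAC subrr add0r normr_nat.
move=> y [_ /= /eqP yx]; rewrite msetE2 msetnE (negbTE yx) addn0.
by rewrite subrr normr0.
Qed.

Lemma TV_Lip_add (Y : ptopologicalType) (F : conf R Y -> R) w n x : TV_Lip F ->
  `|F (conf_add w (conf_dirac R n x)) - F w| <= n%:R.
Proof. by move=> [_ lipF]; rewrite -(dist_TV_add w n x); exact: lipF. Qed.

Lemma poisson_law_series (q : R) : 0 <= q ->
  series (poisson_law q) @ \oo --> (1 : R).
Proof.
move=> q0.
rewrite (_ : series _ = fun n => expR (- q) * series (exp_coeff q) n); last first.
  apply/funext => n; rewrite /series /= big_distrr /=; apply: eq_bigr => i _.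
  by rewrite poisson_lawE// mulrC.
rewrite [X in _ --> X](_ : _ = expR (- q) * expR q); last first.
  by rewrite -expRD addNr expR0.
apply: cvgM; first exact: cvg_cst.
exact: is_cvg_series_exp_coeff.
Qed.

(** The recursion k pi(k) = q pi(k - 1) leaves q times a partial sum of the masses, which is at most
    1. *)
Lemma poisson_law_mean_le (q : R) n : 0 <= q ->
  \sum_(0 <= k < n) k%:R * poisson_law q k <= q.
Proof.
move=> q0; case: n => [|n]; first by rewrite big_nil.
rewrite big_nat_recl// mul0r add0r.
under eq_bigr do rewrite poisson_lawS//.
rewrite -big_distrr /= -[leRHS]mulr1 ler_wpM2l//.
have nd : nondecreasing_seq (series (poisson_law q)).
  by apply/nondecreasing_seqP => k; rewrite seriesSr lerDl poisson_law_ge0.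
have cs := cvgP _ (poisson_law_series q0).
by have := nondecreasing_cvgn_le nd cs n; rewrite (cvg_lim _ (poisson_law_series q0)).
Qed.

(** Write u(n) = u(0) + (u(n) - u(0)): the first part sums to u(0), and the second is dominated by n
    pi(n), hence absolutely summable with sum at most q. In particular [limn] is a genuine limit
    here. *)
Lemma poisson_mean_lipschitz (q : R) (u : nat -> R) : 0 <= q ->
  (forall n, `|u n - u 0%N| <= n%:R) ->
  `|limn (series (fun n => u n * poisson_law q n)) - u 0%N| <= q.
Proof.
move=> q0 lipu; pose v n := (u n - u 0%N) * poisson_law q n.
have nv n : `|v n| <= n%:R * poisson_law q n.
  by rewrite normrM (ger0_norm (poisson_law_ge0 _ _))// ler_wpM2r// poisson_law_ge0.
have sv n : \sum_(0 <= k < n) `|v k| <= q.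
  apply: le_trans (poisson_law_mean_le n q0).
  exact: ler_sum.
have cv : cvgn (series v).
  apply: normed_cvg; apply: nondecreasing_is_cvgn.
    by apply/nondecreasing_seqP => k /=; rewrite /series /= big_nat_recr//= lerDl.
  by exists q => _ [n _ <-]; exact: sv.
rewrite (_ : series _ = series v + (fun n => u 0%N * series (poisson_law q) n)); last first.
  apply/funext => n; rewrite /series /= fctE big_distrr -big_split /=.
  by apply: eq_bigr => k _; rewrite /v; ring.
have c1 : u 0%N * series (poisson_law q) n @[n --> \oo] --> u 0%N * 1.
  by apply: cvgM; [exact: cvg_cst|exact: poisson_law_series].
rewrite (cvg_lim _ (cvgD cv c1))// mulr1 addrK.
rewrite -lim_norm//; apply: limr_le; first exact: is_cvg_norm.
apply: nearW => n; apply: le_trans (sv n); exact: ler_norm_sum.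
Qed.

(* With mean b of a(n) under a Poisson law of small rate q, (a(n) - b)^2 is
   a(1)^2 when n = 1, up to terms of expectation O(q^2). *)
Lemma variance_one_jump (q : R) (a : nat -> R) (b : R) n : 0 <= q <= 1 ->
  a 0%N = 0 -> (forall k, `|a k| <= k%:R) -> `|b| <= q ->
  `|(a n - b) ^+ 2 - (if n == 1%N then a 1%N ^+ 2 else 0)| <=
    q ^+ 2 + 3 * q * n%:R + 9 / 2 * (n%:R * n.-1%:R).
Proof.
move=> /andP[q0 q1] a0 la bq.
have bq' : - q <= b <= q by rewrite -ler_norml.
case: n => [|[|n]] /=.
- rewrite a0 sub0r sqrrN subr0 mulr0 mul0r mulr0 !addr0 normrX.
  by rewrite lerXn2r// nnegrE.
- rewrite !mulr0 addr0 mulr1 (_ : _ - _ = b ^+ 2 - 2 * (a 1%N * b)); last by ring.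
  apply: (le_trans (ler_normB _ _)); apply: lerD.
    by rewrite normrX lerXn2r// nnegrE.
  have ab : `|a 1%N * b| <= q.
    by rewrite normrM -[leRHS]mul1r ler_pM//; exact: la.
  by rewrite normrM ger0_norm//; lra.
- rewrite subr0 ger0_norm ?sqr_ge0//.
  (* Here y = k - 2 for k >= 2 points. Since q <= 1, |x - b| <= k + 1, and (k + 1)^2 <= (9/2) k (k -
     1) with equality at k = 2: this is the origin of 9/2. The product k (k - 1) is used because its
     Poisson mean is q^2. *)
  have H x (y : R) : 0 <= y -> `|x| <= y + 2 ->
      (x - b) ^+ 2 <= q ^+ 2 + 3 * q * (y + 2) + 9 / 2 * ((y + 2) * (y + 1)).
    move=> y0; rewrite ler_norml => xy.
    have h : `|x - b| <= y + 3 by rewrite ler_norml; lra.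
    have h2 : (x - b) ^+ 2 <= (y + 3) ^+ 2.
      by rewrite -real_normK ?num_real// lerXn2r// nnegrE; lra.
    have q2 := sqr_ge0 q; have y2 := sqr_ge0 y; have qy := mulr_ge0 q0 y0.
    rewrite (_ : (y + 3) ^+ 2 = y ^+ 2 + 6 * y + 9) in h2; last by ring.
    rewrite (_ : (y + 2) * (y + 1) = y ^+ 2 + 3 * y + 2); last by ring.
    by rewrite mulrDr -!mulrA; lra.
  have e2 : n.+2%:R = n%:R + 2 :> R by rewrite -addn2 natrD.
  have e1 : n.+1%:R = n%:R + 1 :> R by rewrite -addn1 natrD.
  by have := H (a n.+2) n%:R (ler0n _ _); rewrite -e1 -e2; apply; exact: la.
Qed.

End one_coordinate.

Section image_form_reduction.
Variables (R : realType) (Y : ptopologicalType) (F : conf R Y -> R).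
Hypothesis lipF : TV_Lip F.

Definition grad2 (w : conf R Y) (x : Y) : R := `|discrete_grad x F w| ^+ 2.

Lemma grad2_01 w x : 0 <= grad2 w x <= 1.
Proof.
rewrite sqr_ge0 /= exprn_ile1// /discrete_grad.
exact: (TV_Lip_add w 1 x lipF).
Qed.

Variables (N : nat) (zeta : 'I_N -> Y).
Context d (Omega : measurableType d) (Pr : probability Omega R).
Variables (X : 'I_N -> {mfun Omega >-> nat}) (p : 'I_N -> R).
Hypothesis p01 : forall k, 0 <= p k <= 1.
Hypothesis X_poisson : forall k n,
  distribution Pr (X k) [set n] = (poisson_law (p k) n)%:E.
Hypothesis X_indep : mutually_independent Pr (fun k => (X k : Omega -> nat)).

Definition count_vec (w : Omega) : {ffun 'I_N -> nat} := [ffun k => X k w].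

Definition conf_vec (v : 'I_N -> nat) : conf R Y :=
  \big[@conf_add R Y/point]_(k < N) conf_dirac R (v k) (zeta k).

Let p0 k : 0 <= p k. Proof. by have /andP[] := p01 k. Qed.

Lemma count_vec_poisson : is_poisson_vec Pr count_vec p.
Proof.
have E (c : {ffun 'I_N -> nat}) : count_vec @^-1` [set c] =
    \bigcap_(k in [set` [set: 'I_N]%SET]) (X k @^-1` [set c k]).
  apply/seteqP; split => [w /= <- k _|w /= wc]; first by rewrite /= ffunE.
  by apply/ffunP => k; rewrite ffunE; apply: wc; rewrite /= inE.
split => c.
  rewrite E; apply: fin_bigcap_measurable => // k _.
  by rewrite -[X in measurable X]setTI; exact: measurable_funP.
rewrite E X_indep//.
transitivity (\prod_(k < N) Pr (X k @^-1` [set c k]))%E.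
  by apply: eq_bigl => k; rewrite inE.
rewrite /poisson_vec -prodEFin; apply: eq_bigr => k _.
by rewrite -X_poisson.
Qed.

Let mV := count_vec_poisson.1.

Lemma conf_vecD1 m v :
  conf_vec v = conf_add (conf_omit R zeta m v) (conf_dirac R (v m) (zeta m)).
Proof. by rewrite /conf_vec (bigD1 m)//= conf_addC. Qed.

Lemma eq_conf_omit m (v v' : 'I_N -> nat) : (forall k, k != m -> v k = v' k) ->
  conf_omit R zeta m v = conf_omit R zeta m v'.
Proof. by move=> vv'; apply: eq_bigr => k km; rewrite vv'. Qed.

Section coordinate.
Variable m : 'I_N.

Let a (v : {ffun 'I_N -> nat}) n :=
  F (conf_add (conf_omit R zeta m v) (conf_dirac R n (zeta m))).
Let S v := limn (series (fun n => a v n * poisson_law (p m) n)).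
Let Z v := (a v (v m) - S v) ^+ 2.
(** [A] is the part of the squared deviation [Z] coming from exactly one point at coordinate m, and
    [rem] bounds the rest. [g] has the full configuration in place of the one with coordinate m
    omitted. *)
Let A (v : {ffun 'I_N -> nat}) : R := if v m == 1%N then grad2 (conf_omit R zeta m v) (zeta m) else 0.
Let rem (v : {ffun 'I_N -> nat}) : R :=
  p m ^+ 2 + 3 * p m * (v m)%:R + 9 / 2 * ((v m)%:R * (v m).-1%:R).
Let g (v : {ffun 'I_N -> nat}) : R := grad2 (conf_vec v) (zeta m).

Let a_omit v : a v 0%N = F (conf_omit R zeta m v).
Proof. by rewrite /a /conf_dirac msetn0 [conf_add _ _]msetD0. Qed.

Let aLip v n : `|a v n - a v 0%N| <= n%:R.
Proof. by rewrite a_omit; exact: TV_Lip_add. Qed.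

Let Z_A v : `|Z v - A v| <= rem v.
Proof.
have := @variance_one_jump _ (p m) (fun n => a v n - a v 0%N) (S v - a v 0%N) (v m)
  (p01 m) (subrr _) (aLip v) (poisson_mean_lipschitz (p0 m) (aLip v)).
rewrite (_ : a v (v m) - a v 0%N - (S v - a v 0%N) = a v (v m) - S v); last by ring.
rewrite -/(Z v) /A /rem (_ : grad2 _ _ = (a v 1%N - a v 0%N) ^+ 2)//.
by rewrite /grad2 real_normK ?num_real// /discrete_grad a_omit.
Qed.

Let g01 v : 0 <= g v <= 1. Proof. exact: grad2_01. Qed.

Let A0 v : 0 <= A v.
Proof. by rewrite /A; case: ifP => // _; have /andP[] := grad2_01 (conf_omit R zeta m v) (zeta m). Qed.

Let Z0 v : 0 <= Z v. Proof. exact: sqr_ge0. Qed.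

Let rem0 v : 0 <= rem v.
Proof. by rewrite !addr_ge0// ?mulr_ge0 ?sqr_ge0. Qed.

Let E (f : {ffun 'I_N -> nat} -> R) := (\int[Pr]_w (f (count_vec w))%:E)%E.

Let E_le f h : (forall v, 0 <= f v) -> (forall v, f v <= h v) -> (E f <= E h)%E.
Proof.
move=> f0 fh; apply: ge0_le_integral => //.
- by move=> w _; rewrite lee_fin.
- exact: (countable_measurable_fine mV f).
- exact: (countable_measurable_fine mV h).
- by move=> w _; rewrite lee_fin.
Qed.

Let E_D f h : (forall v, 0 <= f v) -> (forall v, 0 <= h v) ->
  (E (fun v => f v + h v)%R = E f + E h)%E.
Proof.
move=> f0 h0; rewrite /E -ge0_integralD//.
- by move=> w _; rewrite lee_fin.
- exact: (countable_measurable_fine mV f).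
- by move=> w _; rewrite lee_fin.
- exact: (countable_measurable_fine mV h).
Qed.

Let E_Z k f : 0 <= k -> (forall v, 0 <= f v) -> (E (fun v => k * f v)%R = k%:E * E f)%E.
Proof.
move=> k0 f0; rewrite /E -ge0_integralZl_EFin//.
- by move=> w _; rewrite lee_fin.
- exact: (countable_measurable_fine mV f).
Qed.

Let E_cst k : (E (fun=> k) = k%:E)%E.
Proof. by rewrite /E integral_cst//= probability_setT mule1. Qed.

Let E_mecke f : (forall v, 0 <= f v) ->
  (E (fun v => (v m)%:R * f v)%R = (p m)%:E * E (fun v => f (incr m v)))%E.
Proof.
by move=> f0; rewrite /E -(mecke p0 count_vec_poisson m (h := fun v => (f v)%:E)).
Qed.

Let E_count : (E (fun v => (v m)%:R) = (p m)%:E)%E.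
Proof.
have := E_mecke (f := fun=> 1) (fun=> ler01); rewrite E_cst mule1 => <-.
by apply: eq_integral => w _; rewrite mulr1.
Qed.

(** The three terms give p^2 + 3 p^2 + (9/2) p^2 with p = p_m, the last because [E_mecke] turns
    E[V_m (V_m - 1)] into p E[V_m] = p^2. *)
Let E_rem : (E rem <= (9 * p m ^+ 2)%:E)%E.
Proof.
rewrite /rem E_D; last 2 first.
- by move=> v; rewrite addr_ge0// ?mulr_ge0 ?sqr_ge0.
- by move=> v; rewrite ?mulr_ge0.
rewrite E_D; last 2 first.
- by move=> v; exact: sqr_ge0.
- by move=> v; rewrite ?mulr_ge0.
rewrite E_cst !E_Z ?mulr_ge0// E_count E_mecke//.
rewrite (_ : E (fun v => (incr m v m).-1%:R) = E (fun v => (v m)%:R)); last first.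
  by apply: eq_integral => w _; rewrite ffunE eqxx addn1.
rewrite E_count -!EFinM -!EFinD lee_fin.
by have := sqr_ge0 (p m); lra.
Qed.

(** [A] lives on v_m = 1, so it equals v_m A and the Mecke formula applies. After the increment the
    condition reads v_m = 0, where omitting coordinate m changes nothing, so [g] appears. *)
Let E_A : (E A = (p m)%:E * E (fun v => if v m == 0%N then g v else 0)%R)%E.
Proof.
rewrite (_ : E A = E (fun v => (v m)%:R * A v)); last first.
  by apply: eq_integral => w _; rewrite /A; case: eqP => [->|]; rewrite ?mul1r// mulr0.
rewrite E_mecke//; congr (_ * _)%E; apply: eq_integral => w _; congr EFin.
set v := count_vec w; rewrite /A ffunE eqxx addn1 eqSS; case: eqP => // v0.
rewrite /g (conf_vecD1 m v) v0 /conf_dirac msetn0 [conf_add _ _]msetD0.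
congr grad2; apply: eq_conf_omit => k km.
by rewrite ffunE (negbTE km) addn0.
Qed.

Let EA_le : (E A <= (p m)%:E * E g)%E.
Proof.
rewrite E_A lee_wpmul2l ?lee_fin//; apply: E_le => v.
  by case: ifP => // _; have /andP[] := g01 v.
by case: ifP => // _; have /andP[] := g01 v.
Qed.

(** Removing the restriction v_m = 0 costs at most p_m P(V_m >= 1) <= p_m E[V_m], since g <= 1. *)
Let le_EA : ((p m)%:E * E g <= E A + (p m ^+ 2)%:E)%E.
Proof.
rewrite E_A expr2 EFinM -E_count -ge0_muleDr; last 2 first.
- by apply: integral_ge0 => w _; rewrite lee_fin; case: ifP => // _; have /andP[] := g01 (count_vec w).
- by apply: integral_ge0 => w _; rewrite lee_fin.
rewrite lee_wpmul2l ?E_count ?lee_fin// -E_count -E_D//; last first.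
  by move=> v; case: ifP => // _; have /andP[] := g01 v.
apply: E_le => v; have /andP[g0 g1] := g01 v; first by [].
have [v0|] := eqVneq (v m) 0%N; first by rewrite v0 addr0.
by rewrite -lt0n => v1; rewrite add0r (le_trans g1)// ler1n.
Qed.

(** Two inequalities in the extended reals avoid proving finiteness of the variance first. The
    constant 10 is 9 from [E_rem] plus 1 from [le_EA]. *)
Lemma coordinate_variance :
  let EZ := ('E_Pr[fun w => Z (count_vec w)])%E in
  let EG := (\int[Pr]_w (grad2 (conf_vec (count_vec w)) (zeta m))%:E)%E in
  (EZ <= (p m)%:E * EG + (10 * p m ^+ 2)%:E)%E /\
  ((p m)%:E * EG <= EZ + (10 * p m ^+ 2)%:E)%E.
Proof.
rewrite unlock /= -/(E Z) -/(E g).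
have p2 := sqr_ge0 (p m).
have ZA v : Z v <= A v + rem v by have := Z_A v; rewrite ler_norml; lra.
have AZ v : A v <= Z v + rem v by have := Z_A v; rewrite ler_norml; lra.
split.
  apply: le_trans (E_le Z0 ZA) _; rewrite E_D//; apply: leeD => //.
  by apply: le_trans E_rem _; rewrite lee_fin; lra.
apply: (le_trans le_EA); rewrite (_ : 10 * _ = 9 * p m ^+ 2 + p m ^+ 2); last by ring.
rewrite EFinD addeA leeD2r//; apply: le_trans (E_le A0 AZ) _.
by rewrite E_D// leeD2l.
Qed.

End coordinate.

(** This is E[int G(w^N, x) M_N(dx)] of the overview. *)
Definition mean_grad : \bar R :=
  (\sum_(m < N) (p m)%:E *
     \int[Pr]_w (grad2 (conf_vec (count_vec w)) (zeta m))%:E)%E.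

Lemma image_form_mean_grad :
  (image_dirichlet_form zeta Pr X F <=
     mean_grad + (10 * \sum_(m < N) p m ^+ 2)%:E)%E /\
  (mean_grad <=
     image_dirichlet_form zeta Pr X F + (10 * \sum_(m < N) p m ^+ 2)%:E)%E.
Proof.
rewrite /mean_grad /image_dirichlet_form big_distrr/= -sumEFin.
suff H m : ('E_Pr[fun w => let w_m := conf_omit R zeta m (fun k => X k w) in
     ((F (conf_add w_m (conf_dirac R (X m w) (zeta m)))
       - limn (series (fun tau : nat =>
           F (conf_add w_m (conf_dirac R tau (zeta m)))
           * fine (distribution Pr (X m) [set tau])))) ^+ 2)%R] =
  'E_Pr[fun w => ((F (conf_add (conf_omit R zeta m (count_vec w)) (conf_dirac R (count_vec w m) (zeta m)))
   - limn (series (fun n => F (conf_add (conf_omit R zeta m (count_vec w)) (conf_dirac R n (zeta m)))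
        * poisson_law (p m) n))) ^+ 2)%R])%E.
  by split; rewrite -big_split /=; apply: lee_sum => m _; rewrite H;
    have [] := coordinate_variance m.
congr expectation; apply/funext => w /=.
have -> : conf_omit R zeta m (fun k => X k w) = conf_omit R zeta m (count_vec w).
  by apply: eq_conf_omit => k _; rewrite ffunE.
rewrite ffunE; congr GRing.exp; congr GRing.add; congr (- limn (series _)).
by apply/funext => n; rewrite X_poisson.
Qed.

End image_form_reduction.

(** * Discretization along a partition *)

Section discretization.
Variables (R : realType) (Y : ptopologicalType).

Lemma conf_dirac_add n1 n2 (x : Y) :
  conf_dirac R (n1 + n2) x = conf_add (conf_dirac R n1 x) (conf_dirac R n2 x).
Proof. by rewrite -!conf_of_nseq -conf_of_cat nseqD. Qed.

Lemma conf_dirac0 (x : Y) : conf_dirac R 0 x = point.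
Proof. exact: msetn0. Qed.

Lemma conf_vec_incr r (a : 'I_r -> Y) (c : 'I_r -> nat) j :
  conf_vec R a (fun i => (c i + (i == j))%N) =
  conf_add (conf_vec R a c) (conf_dirac R 1 (a j)).
Proof.
rewrite /conf_vec; under eq_bigr do rewrite conf_dirac_add.
rewrite big_split /= [X in conf_add _ X](bigD1 j)//= eqxx.
rewrite [X in conf_add (conf_dirac R 1 (a j)) X]big1 ?Monoid.mulm1//.
by move=> i /negbTE ->; rewrite conf_dirac0.
Qed.

Lemma cnt_add A (w1 w2 : conf R Y) : cnt A (conf_add w1 w2) = (cnt A w1 + cnt A w2)%N.
Proof. by rewrite (cnt_perm _ (perm_pts_add _ _)) count_cat. Qed.

Lemma cnt_conf_vec A N (zeta : 'I_N -> Y) (v : 'I_N -> nat) :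
  cnt A (conf_vec R zeta v) = (\sum_(k < N | zeta k \in A) v k)%N.
Proof.
rewrite /conf_vec (big_morph _ (cnt_add A) (id1 := 0%N)); last by rewrite /cnt pts_point.
rewrite [RHS]big_mkcond; apply: eq_bigr => k _.
rewrite /cnt pts_dirac count_nseq /=.
by case: (zeta k \in A); rewrite ?mul1n ?mul0n.
Qed.

Variables (r : nat) (iota : Y -> 'I_r) (a : 'I_r -> Y).
Let rho y := a (iota y).

Definition cell_counts (w : conf R Y) : {ffun 'I_r -> nat} :=
  [ffun i => cnt (iota @^-1` [set i]) w].

Lemma conf_of_map (w : conf R Y) :
  conf_of R (map rho (pts w)) = conf_vec R a (cell_counts w).
Proof.
(* Counting in an arbitrary list, rather than in [pts w], lets the induction add one point at a
   time. *)
rewrite (_ : conf_vec R a _ =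
    conf_vec R a (fun i => count (mem (iota @^-1` [set i])) (pts w))); last first.
  by apply: eq_bigr => i _; rewrite ffunE.
elim/last_ind: (pts w) => [|s x ih].
  rewrite /conf_vec big1 => [|i _]; last by rewrite conf_dirac0.
  by rewrite -[RHS]conf_of_pts pts_point.
rewrite map_rcons conf_of_rcons ih -conf_vec_incr.
apply: eq_bigr => i _; congr conf_dirac.
rewrite -cats1 count_cat /= addn0; congr (_ + nat_of_bool _)%N.
by apply/idP/idP => [/eqP ->|/set_mem <-]; [exact: mem_set|exact: eqxx].
Qed.

Lemma sum_cell_counts w : (\sum_(i < r) cell_counts w i)%N = size (pts w).
Proof.
under eq_bigr do rewrite ffunE /cnt -sum1_count.
rewrite (exchange_big_dep xpredT)//= -sum1_size; apply: eq_bigr => y _.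
rewrite (eq_bigl (pred1 (iota y))) ?big_pred1_eq// => i.
by apply/idP/eqP => [/set_mem ->|->]//; exact: mem_set.
Qed.

Lemma cell_counts_conf_vec N (zeta : 'I_N -> Y) (v : {ffun 'I_N -> nat}) :
  cell_counts (conf_vec R zeta v) = group_counts (iota \o zeta) v.
Proof.
apply/ffunP => j; rewrite !ffunE cnt_conf_vec; apply: eq_bigl => k.
by apply/idP/eqP => [/set_mem|]//; exact: mem_set.
Qed.

Variables (F : conf R Y -> R) (lipF : TV_Lip F) (n0 : nat) (e : R).
Hypothesis Frho : forall s : seq Y, (size s <= n0.+1)%N ->
  `|F (conf_of R s) - F (conf_of R (map rho s))| < e.

Definition cell_grad2 (c : 'I_r -> nat) (j : 'I_r) : R :=
  grad2 F (conf_vec R a c) (a j).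

Definition many_points (c : 'I_r -> nat) : R := (n0 < \sum_(i < r) c i)%N%:R.

Lemma cell_grad2_01 c j : 0 <= cell_grad2 c j <= 1.
Proof. exact: grad2_01. Qed.

(** With at most n0 points, [Frho] applies before and after adding x, hence the bound n0 + 1 there.
    The two gradients differ by at most 2 e and their sum is at most 2 in absolute value, so the
    squares differ by at most 4 e. With more points, both squares lie in [0, 1]. *)
Lemma grad2_discretize w x :
  `|grad2 F w x - cell_grad2 (cell_counts w) (iota x)| <=
    4 * e + many_points (cell_counts w).
Proof.
have e0 : 0 < e by apply: le_lt_trans (Frho (s := [::]) _).
rewrite /many_points sum_cell_counts; case: ltnP => wn /=.
  have := grad2_01 lipF w x; have := cell_grad2_01 (cell_counts w) (iota x).
  by rewrite ler_norml; lra.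
rewrite addr0 /cell_grad2 /grad2 /discrete_grad.
have E : conf_add (conf_vec R a (cell_counts w)) (conf_dirac R 1 (a (iota x))) =
    conf_of R (map rho (rcons (pts w) x)).
  by rewrite map_rcons conf_of_rcons conf_of_map.
rewrite E -conf_of_map.
have -> : conf_add w (conf_dirac R 1 x) = conf_of R (rcons (pts w) x).
  by rewrite conf_of_rcons conf_of_pts.
have -> : F w = F (conf_of R (pts w)) by rewrite conf_of_pts.
have h1 := Frho (s := pts w) (leqW wn).
have h2 : `|F (conf_of R (rcons (pts w) x)) - F (conf_of R (map rho (rcons (pts w) x)))| < e.
  by apply: Frho; rewrite size_rcons.
have b1 := TV_Lip_add (conf_of R (pts w)) 1 x lipF.
have b2 := TV_Lip_add (conf_of R (map rho (pts w))) 1 (rho x) lipF.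
rewrite -!conf_of_rcons in b1 b2; rewrite -map_rcons in b2.
rewrite !real_normK ?num_real//.
move: h1 h2 b1 b2.
set A := F _; set B := F _; set C := F _; set D := F _.
move=> h1 h2 b1 b2.
rewrite subr_sqr normrM.
apply: (@le_trans _ _ ((2 * e) * 2)); last by lra.
move: h1 h2 b1 b2; rewrite !ltr_norml !ler_norml => h1 h2 b1 b2; apply: ler_pM => //; rewrite ler_norml; lra.
Qed.

End discretization.

Section integral_estimates.
Context d (T : measurableType d) (R : realType) (mu : probability T R).

Lemma integral_cst_prob (c : R) : (\int[mu]_x c%:E = c%:E)%E.
Proof. by rewrite integral_cst//= probability_setT mule1. Qed.

Lemma integral_dist_le (f h t : T -> R) b : 0 <= b ->
  measurable_fun setT f -> measurable_fun setT h -> measurable_fun setT t ->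
  (forall x, 0 <= f x <= 1) -> (forall x, 0 <= h x <= 1) ->
  (forall x, 0 <= t x <= 1) -> (forall x, `|f x - h x| <= b + t x) ->
  `|fine (\int[mu]_x (f x)%:E) - fine (\int[mu]_x (h x)%:E)| <=
    b + fine (\int[mu]_x (t x)%:E).
Proof.
move=> b0.
(* The one-sided bound only adds nonnegative integrals; it is then used in both directions. *)
have main (f1 f2 t1 : T -> R) : measurable_fun setT f1 -> measurable_fun setT f2 ->
    measurable_fun setT t1 -> (forall x, 0 <= f1 x <= 1) ->
    (forall x, 0 <= f2 x <= 1) -> (forall x, 0 <= t1 x <= 1) ->
    (forall x, f1 x <= f2 x + (b + t1 x)) ->
    fine (\int[mu]_x (f1 x)%:E) <= fine (\int[mu]_x (f2 x)%:E) +
      (b + fine (\int[mu]_x (t1 x)%:E)).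
  move=> mf1 mf2 mt1 f1_01 f2_01 t1_01 f12.
  rewrite -lee_fin !EFinD !fineK ?integral_fin_num01//.
  rewrite -[b%:E]integral_cst_prob.
  have f20 x : 0 <= f2 x by have /andP[] := f2_01 x.
  have t10 x : 0 <= t1 x by have /andP[] := t1_01 x.
  have mf1' : measurable_fun setT (EFin \o f1) by exact/measurable_EFinP.
  have mf2' : measurable_fun setT (EFin \o f2) by exact/measurable_EFinP.
  have mt1' : measurable_fun setT (EFin \o t1) by exact/measurable_EFinP.
  have mb : measurable_fun setT (fun _ : T => b%:E) by exact: measurable_cst.
  have mbt : measurable_fun setT (fun x => b%:E + (t1 x)%:E)%E by exact: emeasurable_funD.
  have E1 : (\int[mu]_x (b%:E + (t1 x)%:E) = \int[mu]_x b%:E + \int[mu]_x (t1 x)%:E)%E.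
    by apply: ge0_integralD => // x _; rewrite lee_fin.
  have E2 : (\int[mu]_x ((f2 x)%:E + (b%:E + (t1 x)%:E)) =
      \int[mu]_x (f2 x)%:E + \int[mu]_x (b%:E + (t1 x)%:E))%E.
    by apply: ge0_integralD => // x _; rewrite -?EFinD lee_fin ?addr_ge0.
  rewrite -E1 -E2.
  apply: ge0_le_integral => //.
  - by move=> x _; rewrite lee_fin; have /andP[] := f1_01 x.
  - exact: emeasurable_funD.
  - by move=> x _; rewrite -!EFinD lee_fin.
move=> mf mh mt f01 h01 t01 fh.
have h1 : fine (\int[mu]_x (f x)%:E) <= fine (\int[mu]_x (h x)%:E) +
    (b + fine (\int[mu]_x (t x)%:E)).
  by apply: main => // x; have := fh x; rewrite ler_norml; lra.
have h2 : fine (\int[mu]_x (h x)%:E) <= fine (\int[mu]_x (f x)%:E) +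
    (b + fine (\int[mu]_x (t x)%:E)).
  by apply: main => // x; have := fh x; rewrite ler_norml; lra.
by rewrite ler_norml; lra.
Qed.

(** Markov's inequality for the total count: more than n0 points means at least n0 + 1, and the mean
    of each count is [mecke] with h = 1. *)
Lemma many_points_le r (W : T -> {ffun 'I_r -> nat}) (q : 'I_r -> R) n0 :
  (forall j, 0 <= q j) -> is_poisson_vec mu W q ->
  fine (\int[mu]_w (many_points R n0 (W w))%:E) <= (\sum_(j < r) q j) / n0.+1%:R.
Proof.
move=> q0 PW; have [mW _] := PW.
have meas (f : {ffun 'I_r -> nat} -> R) : measurable_fun setT (fun w => (f (W w))%:E).
  exact: (countable_measurable_fine mW f).
have I : (\int[mu]_w (many_points R n0 (W w))%:E <= ((\sum_(j < r) q j) / n0.+1%:R)%:E)%E.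
  apply: (@le_trans _ _
      (\int[mu]_w ((n0.+1%:R^-1)%:E * \sum_(j < r) ((W w j)%:R%:E * 1)))%E).
    apply: ge0_le_integral => //.
    - by move=> w _; rewrite lee_fin.
    - exact: (meas (many_points R n0)).
    - have := meas (fun c => n0.+1%:R^-1 * \sum_(j < r) (c j)%:R).
      apply: eq_measurable_fun => w _; rewrite EFinM -sumEFin; congr (_ * _)%E.
      by apply: eq_bigr => j _; rewrite mule1.
    - move=> w _; under eq_bigr do rewrite mule1.
      rewrite sumEFin -natr_sum -EFinM lee_fin /many_points ler_pdivlMl ?ltr0n//.
      by case: ltnP => [h|_]; rewrite ?mulr1 ?mulr0// ler_nat.
  have mc j : measurable_fun setT (fun w => (W w j)%:R%:E * 1 : \bar R)%E.
    by apply: (eq_measurable_fun _ _ (meas (fun c => (c j)%:R))) => w _; rewrite mule1.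
  have ms : measurable_fun setT (fun w => \sum_(j < r) ((W w j)%:R%:E * 1) : \bar R)%E.
    exact: emeasurable_sum.
  rewrite ge0_integralZl_EFin//; last by move=> w _; apply: sume_ge0 => j _; rewrite mule_ge0.
  rewrite mulrC EFinM lee_wpmul2l// ge0_integral_sum//.
  rewrite -sumEFin; apply: lee_sum => j _.
  rewrite (mecke q0 PW j (h := fun=> 1%E))//.
  by rewrite integral_cst//= probability_setT !mule1.
rewrite -lee_fin fineK//; apply: integral_fin_num01.
  exact: (countable_measurable_fun mW (many_points R n0)).
by move=> w; rewrite /many_points; case: ltnP => _ /=; rewrite ?lexx ?ler01.
Qed.

End integral_estimates.

(** * The Dirichlet form of the Poisson process, through its cell counts *)

Section limit_form.
Variables (R : realType) (Y : completePseudoMetricType R).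
Variables (M : probability (borel Y) R) (P : probability (borel (conf R Y)) R).
Hypothesis poissonP : poisson_process_law M P.
Variable F : conf R Y -> R.
Hypothesis lipF : TV_Lip F.

Definition mean_grad2 (w : conf R Y) : R :=
  fine (\int[M]_x (grad2 F w x)%:E).

Lemma measurable_grad2 w : measurable_fun setT (grad2 F w : borel Y -> R).
Proof.
apply: continuous_borel_measurable => x; rewrite /grad2 /discrete_grad.
apply: cvgM; apply: cvg_norm; apply: cvgB; try exact: cvg_cst;
  by apply: continuous_comp; [exact: continuous_addpoint|exact: lipF.1].
Qed.

Lemma mean_grad2E w : (\int[M]_x (grad2 F w x)%:E = (mean_grad2 w)%:E)%E.
Proof.
rewrite fineK//; apply: integral_fin_num01; first exact: measurable_grad2.
by move=> x; exact: grad2_01.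
Qed.

Lemma mean_grad2_01 w : 0 <= mean_grad2 w <= 1.
Proof.
rewrite -!lee_fin -mean_grad2E; apply/andP; split.
  by apply: integral_ge0 => x _; rewrite lee_fin; have /andP[] := grad2_01 lipF w x.
rewrite -[1%:E](integral_cst_prob M).
apply: ge0_le_integral => //.
- by move=> x _; rewrite lee_fin; have /andP[] := grad2_01 lipF w x.
- by apply/measurable_EFinP; exact: measurable_grad2.
- by move=> x _; rewrite lee_fin; have /andP[] := grad2_01 lipF w x.
Qed.

Section cells.
Variables (r : nat) (iota : Y -> 'I_r) (a : 'I_r -> Y).
Hypothesis good_iota : forall i, good_set M (iota @^-1` [set i]).

Definition cell_rate (j : 'I_r) : R := fine (M (iota @^-1` [set j] : set (borel Y))).

Lemma measurable_cell j : measurable (iota @^-1` [set j] : set (borel Y)).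
Proof. exact: baire_set_measurable (good_iota j).1. Qed.

Lemma cell_rate_ge0 j : 0 <= cell_rate j.
Proof. exact: fine_ge0. Qed.

Lemma integral_cells (f : 'I_r -> R) : (forall j, 0 <= f j) ->
  (\int[M]_x (f (iota x))%:E = (\sum_(j < r) cell_rate j * f j)%:E)%E.
Proof.
move=> f0.
transitivity (\int[M]_x (\sum_(j < r) (f j)%:E * (\1_(iota @^-1` [set j]) x)%:E))%E.
  apply: eq_integral => x _; rewrite (bigD1 (iota x))//= indicE mem_set//= mule1.
  rewrite big1 ?adde0// => j jx; rewrite indicE memNset ?mule0//=.
  by move=> e; move: jx; rewrite e eqxx.
have mi j : measurable_fun setT (fun x : borel Y => (\1_(iota @^-1` [set j]) x)%:E : \bar R).
  by apply/measurable_EFinP; apply: measurable_indic; exact: measurable_cell.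
have mfi j : measurable_fun setT (fun x : borel Y => (f j)%:E * (\1_(iota @^-1` [set j]) x)%:E : \bar R)%E.
  exact: emeasurable_funM.
rewrite ge0_integral_sum//; last by move=> j x _; rewrite mule_ge0// lee_fin.
rewrite -sumEFin; apply: eq_bigr => j _.
rewrite ge0_integralZl_EFin// integral_indic//; last exact: measurable_cell.
rewrite setIT mulrC EFinM; congr (_ * _)%E.
by rewrite /cell_rate fineK// fin_num_measure//; exact: measurable_cell.
Qed.

Lemma sum_cell_rate : \sum_(j < r) cell_rate j = 1.
Proof.
have := integral_cells (fun=> ler01); rewrite integral_cst_prob => -[->].
by apply: eq_bigr => j _; rewrite mulr1.
Qed.

(** The definition of the Poisson process enters the argument here only: prescribing the cell counts
    is prescribing w(A_i) on finitely many disjoint measurable sets. *)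
Lemma cell_counts_poisson :
  is_poisson_vec P (cell_counts (R := R) iota : borel (conf R Y) -> _) cell_rate.
Proof.
have [lawP indepP] := poissonP.
have tA : trivIset setT (fun i => iota @^-1` [set i] : set (borel Y)).
  exact: trivIset_preimage1.
have E (c : {ffun 'I_r -> nat}) : (cell_counts iota : borel (conf R Y) -> _) @^-1` [set c] =
    \bigcap_(i in [set` [set: 'I_r]%SET])
      ((fun w : conf R Y => conf_measure w (iota @^-1` [set i])) @^-1` [set (c i)%:R%:E]).
  apply/seteqP; split => [w /= <- i _|w /= wc].
    by rewrite /= ffunE conf_measure_cnt.
  apply/ffunP => i; rewrite ffunE; apply/eqP; rewrite -(eqr_nat R); apply/eqP.
  by have := wc i; rewrite /= inE conf_measure_cnt => /(_ isT)[].
split => c.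
  rewrite E; apply: fin_bigcap_measurable => // i _.
  have mc := measurable_cnt (good_iota i).1.
  have := mc measurableT [set (c i)%:R] (measurable_set1 _).
  rewrite setTI; congr measurable; apply/seteqP; split => w /=.
    by rewrite conf_measure_cnt => ->.
  by rewrite conf_measure_cnt => -[].
rewrite E (indepP r (fun i => iota @^-1` [set i]) measurable_cell tA)//.
transitivity (\prod_(i < r) P ((fun w : conf R Y =>
    conf_measure w (iota @^-1` [set i])) @^-1` [set (c i)%:R%:E]))%E.
  by apply: eq_bigl => i; rewrite inE.
rewrite /poisson_vec -prodEFin; apply: eq_bigr => i _.
by rewrite -lawP; last exact: measurable_cell.
Qed.

End cells.
End limit_form.

Section discretization_error.
Variables (R : realType) (Y : completePseudoMetricType R).
Variables (M : probability (borel Y) R) (F : conf R Y -> R).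
Hypothesis lipF : TV_Lip F.

Lemma exists_discretization n0 e : hausdorff_space Y -> compact [set: Y] -> 0 < e ->
  exists (r : nat) (iota : Y -> 'I_r) (a : 'I_r -> Y),
    (forall i, good_set M (iota @^-1` [set i])) /\
    (forall s : seq Y, (size s <= n0.+1)%N ->
      `|F (conf_of R s) - F (conf_of R (map (fun y => a (iota y)) s))| < e).
Proof.
move=> hausY compactY e0.
have [d d0 dP] := uniform_conf_of compactY lipF.1 n0.+1 e0.
have [r [iota [a [aP good]]]] := good_partition M hausY compactY d0.
by exists r, iota, a; split => // s sn; exact: dP.
Qed.

Lemma many_points01 r n0 (c : 'I_r -> nat) : 0 <= many_points R n0 c <= 1.
Proof. by rewrite /many_points; case: ltnP => _ /=; rewrite ?lexx ?ler01. Qed.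

Lemma integral_weighted_sum d (T : measurableType d) (mu : probability T R)
  r (q : 'I_r -> R) (f : 'I_r -> T -> R) : (forall j, 0 <= q j) ->
  (forall j, measurable_fun setT (f j)) -> (forall j x, 0 <= f j x <= 1) ->
  (\int[mu]_x (\sum_(j < r) q j * f j x)%:E =
   (\sum_(j < r) q j * fine (\int[mu]_x (f j x)%:E))%:E)%E.
Proof.
move=> q0 mf f01.
have f0 j x : 0 <= f j x by have /andP[] := f01 j x.
have mfe j : measurable_fun setT (fun x => (f j x)%:E) by exact/measurable_EFinP.
have mqf j : measurable_fun setT (fun x => (q j)%:E * (f j x)%:E)%E.
  exact: emeasurable_funM.
transitivity (\int[mu]_x (\sum_(j < r) (q j)%:E * (f j x)%:E))%E.
  by apply: eq_integral => x _; rewrite -sumEFin.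
rewrite ge0_integral_sum//; last by move=> j x _; rewrite mule_ge0// lee_fin.
rewrite -sumEFin; apply: eq_bigr => j _.
rewrite ge0_integralZl_EFin//; last by move=> x _; rewrite lee_fin.
by rewrite EFinM fineK//; exact: integral_fin_num01.
Qed.

Section cells.
Variables (n0 : nat) (e : R) (r : nat) (iota : Y -> 'I_r) (a : 'I_r -> Y).
Hypothesis good_iota : forall i, good_set M (iota @^-1` [set i]).
Hypothesis Frho : forall s : seq Y, (size s <= n0.+1)%N ->
  `|F (conf_of R s) - F (conf_of R (map (fun y => a (iota y)) s))| < e.

Let e0 : 0 < e. Proof. by apply: le_lt_trans (Frho (s := [::]) _). Qed.
Let e40 : 0 <= 4 * e. Proof. by rewrite mulr_ge0// ltW. Qed.

Let q := cell_rate M iota.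
Let H c j := cell_grad2 a F c j.
(** By [integral_cells], this is the discretized gradient integrated over x against M. *)
Let K (c : {ffun 'I_r -> nat}) := \sum_(j < r) q j * H c j.

Let K01 c : 0 <= K c <= 1.
Proof.
have q0 j : 0 <= q j by exact: cell_rate_ge0.
apply/andP; split.
  by apply: sumr_ge0 => j _; rewrite mulr_ge0//; have /andP[] := cell_grad2_01 a lipF c j.
rewrite -(sum_cell_rate good_iota); apply: ler_sum => j _; rewrite ler_piMr//.
by have /andP[] := cell_grad2_01 a lipF c j.
Qed.

Lemma mean_grad2_discretize w :
  `|mean_grad2 M F w - K (cell_counts (R := R) iota w)| <=
    4 * e + many_points R n0 (cell_counts (R := R) iota w).
Proof.
have h0 j : 0 <= H (cell_counts (R := R) iota w) j.
  by have /andP[] := cell_grad2_01 a lipF (cell_counts (R := R) iota w) j.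
have := @integral_dist_le _ (borel Y) R M (grad2 F w)
  (fun x => H (cell_counts (R := R) iota w) (iota x))
  (fun=> many_points R n0 (cell_counts (R := R) iota w)) (4 * e) e40.
rewrite -/(mean_grad2 M F w) integral_cst_prob /=.
rewrite (integral_cells good_iota h0) /=; apply.
- exact: measurable_grad2.
- have mi : forall c, measurable ((iota : borel Y -> _) @^-1` [set c]).
    exact: measurable_cell good_iota.
  exact: (countable_measurable_fun mi (H (cell_counts (R := R) iota w))).
- exact: measurable_cst.
- by move=> x; exact: grad2_01.
- by move=> x; exact: cell_grad2_01.
- by move=> x; exact: many_points01.
- by move=> x; exact: grad2_discretize.
Qed.

Lemma measurable_cell_counts c :
  measurable ((cell_counts (R := R) iota : borel (conf R Y) -> _) @^-1` [set c]).
Proof.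
rewrite (_ : _ @^-1` _ = \bigcap_(i in [set` [set: 'I_r]%SET])
    ((fun w : conf R Y => (cnt (iota @^-1` [set i]) w)%:R : R) @^-1` [set (c i)%:R])).
  apply: fin_bigcap_measurable => // i _.
  have mc := measurable_cnt (good_iota i).1.
  by have := mc measurableT [set (c i)%:R] (measurable_set1 _); rewrite setTI.
apply/seteqP; split => [w /= <- i _|w /= wc]; first by rewrite /= ffunE.
apply/ffunP => i; rewrite ffunE; apply/eqP; rewrite -(eqr_nat R); apply/eqP.
by apply: wc; rewrite /= inE.
Qed.

(** A measurable approximation that is within 4 e at every w with at most n0 points; it serves to
    prove [mean_grad2] itself measurable. *)
Lemma mean_grad2_approx : exists2 kappa : conf R Y -> R,
  measurable_fun setT (kappa : borel (conf R Y) -> R) &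
  forall w, `|mean_grad2 M F w - kappa w| <= 4 * e + (n0 < size (pts w))%N%:R.
Proof.
exists (K \o cell_counts (R := R) iota); first exact: (countable_measurable_fun measurable_cell_counts K).
by move=> w; have := mean_grad2_discretize w; rewrite /many_points sum_cell_counts.
Qed.

Variables (P : probability (borel (conf R Y)) R) (poissonP : poisson_process_law M P).
Hypothesis mg : measurable_fun setT (mean_grad2 M F : borel (conf R Y) -> R).

(** The cell rates sum to 1, so the Markov bound on large configurations is 1 / (n0 + 1). *)
Lemma dirichlet_form_discretize :
  `|fine (\int[P]_w (mean_grad2 M F w)%:E) -
    \sum_(j < r) q j * fine (\int[P]_w (H (cell_counts (R := R) iota w) j)%:E)| <=
  4 * e + n0.+1%:R^-1.
Proof.
have mH j : measurable_fun setT (fun w : borel (conf R Y) => H (cell_counts (R := R) iota w) j).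
  exact: (countable_measurable_fun measurable_cell_counts (H^~ j)).
have PC := cell_counts_poisson poissonP good_iota.
have := many_points_le n0 (cell_rate_ge0 M iota) PC.
rewrite (sum_cell_rate good_iota) div1r => mp.
have -> : \sum_(j < r) q j * fine (\int[P]_w (H (cell_counts (R := R) iota w) j)%:E) =
    fine (\int[P]_w (K (cell_counts (R := R) iota w))%:E).
  rewrite integral_weighted_sum// => [j|j w]; first exact: cell_rate_ge0.
  exact: cell_grad2_01.
apply: le_trans (lerD (lexx _) mp).
apply: integral_dist_le => //.
- exact: (countable_measurable_fun measurable_cell_counts K).
- exact: (countable_measurable_fun measurable_cell_counts (many_points R n0)).
- by move=> w; exact: mean_grad2_01.
- by move=> w; exact: many_points01.
- by move=> w; exact: mean_grad2_discretize.
Qed.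

Section array.
Variables (N : nat) (zeta : 'I_N -> Y) (p : 'I_N -> R).
Context d (Omega : measurableType d) (Pr : probability Omega R).
Variable V : Omega -> {ffun 'I_N -> nat}.
Hypotheses (p0 : forall k, 0 <= p k) (PV : is_poisson_vec Pr V p).

Let W := group_counts (iota \o zeta) \o V.

(** The discretized gradient depends on m only through the cell of zeta_m, so the weights p_m add up
    to the group rates. With s the sum of the p_m, the error per unit of weight is 4 e + s / (n0 +
    1). *)
Lemma mean_grad_discretize :
  exists2 D : R,
  (\sum_(m < N) (p m)%:E * \int[Pr]_w (grad2 F (conf_vec R zeta (V w)) (zeta m))%:E = D%:E)%E &
  `|D - \sum_(j < r) group_rates (iota \o zeta) p j * fine (\int[Pr]_w (H (W w) j)%:E)| <=
  (\sum_(m < N) p m) * (4 * e + (\sum_(m < N) p m) / n0.+1%:R).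
Proof.
pose g m w := grad2 F (conf_vec R zeta (V w)) (zeta m).
have mgm m : measurable_fun setT (g m).
  exact: (countable_measurable_fun PV.1 (fun v => grad2 F (conf_vec R zeta v) (zeta m))).
exists (\sum_(m < N) p m * fine (\int[Pr]_w (g m w)%:E)).
  rewrite -sumEFin; apply: eq_bigr => m _; rewrite EFinM fineK//.
  by apply: integral_fin_num01 => // w; exact: grad2_01.
have PW : is_poisson_vec Pr W (group_rates (iota \o zeta) p) by exact: poisson_vec_group.
have sum_rates (f : 'I_r -> R) : \sum_(j < r) group_rates (iota \o zeta) p j * f j =
    \sum_(m < N) p m * f (iota (zeta m)).
  rewrite (partition_big (iota \o zeta) predT)//=; apply: eq_bigr => j _.
  by rewrite /group_rates big_distrl /=; apply: eq_bigr => m /eqP ->.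
have gr0 j : 0 <= group_rates (iota \o zeta) p j by exact: sumr_ge0.
have := many_points_le n0 gr0 PW.
rewrite (_ : \sum_(j < r) group_rates _ _ _ = \sum_(m < N) p m); last first.
  by rewrite [RHS](partition_big (iota \o zeta) predT).
move=> mp.
rewrite sum_rates -sumrB; apply: le_trans (ler_norm_sum _ _ _) _.
rewrite [leRHS]big_distrl /=; apply: ler_sum => m _.
rewrite -mulrBr normrM ger0_norm// ler_wpM2l//.
apply: le_trans (lerD (lexx _) mp).
apply: integral_dist_le => //.
- exact: (countable_measurable_fun PW.1 (H^~ (iota (zeta m)))).
- exact: (countable_measurable_fun PW.1 (many_points R n0)).
- by move=> w; exact: grad2_01.
- by move=> w; exact: cell_grad2_01.
- by move=> w; exact: many_points01.
- move=> w; rewrite /W /= -(cell_counts_conf_vec R).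
  exact: grad2_discretize.
Qed.

End array.
End cells.

(** Take e = 1 / (n + 1) and n0 = n. For fixed w the term for large configurations vanishes once n
    >= size (pts w), so the approximations converge at every w, though not uniformly. *)
Lemma measurable_mean_grad2 : hausdorff_space Y -> compact [set: Y] ->
  measurable_fun setT (mean_grad2 M F : borel (conf R Y) -> R).
Proof.
move=> hausY compactY.
have /choice[kappa kP] (n : nat) : exists kappa : conf R Y -> R,
    measurable_fun setT (kappa : borel (conf R Y) -> R) /\
    forall w, `|mean_grad2 M F w - kappa w| <= 4 * n.+1%:R^-1 + (n < size (pts w))%N%:R.
  have e0 : 0 < n.+1%:R^-1 :> R by rewrite invr_gt0 ltr0n.
  have [r [iota [a [gi Frho]]]] := exists_discretization n hausY compactY e0.
  by have [kappa mk kP] := mean_grad2_approx gi Frho; exists kappa.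
apply: (@measurable_fun_cvg _ (borel (conf R Y)) R setT kappa) => [n|w _].
  by have [] := kP n.
apply/cvgrPdist_lt => e e0; near=> n.
have [_ /(_ w)/le_lt_trans] := kP n; apply.
rewrite ltnNge (_ : (_ <= n)%N) ?addr0; last by near: n; exact: nbhs_infty_ge.
rewrite ltr_pdivrMr ?ltr0n// mulrC -ltr_pdivrMr//.
apply: (@le_lt_trans _ _ n%:R); last by rewrite ltr_nat.
by near: n; exact: nbhs_infty_ger.
Unshelve. all: by end_near. Qed.

End discretization_error.

Lemma cvg_poisson_vec (R : realType) r (q_ : nat -> 'I_r -> R) (q : 'I_r -> R) c :
  (forall n j, 0 <= q_ n j) -> (forall j, 0 <= q j) ->
  (forall j, q_ n j @[n --> \oo] --> q j) ->
  poisson_vec (q_ n) c @[n --> \oo] --> poisson_vec q c.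
Proof.
move=> q_0 q0 qq; apply: cvg_big => [|j _]; first exact: mul_continuous.
rewrite poisson_lawE//; under eq_fun do rewrite poisson_lawE//.
apply: cvgM; first apply: cvgM.
- by apply: (cvg_comp _ (fun x : R => x ^+ c j) (qq j)); exact: exprn_continuous.
- exact: cvg_cst.
- by apply: (cvg_comp _ (@expR R) (cvgN (qq j))); exact: continuous_expR.
Qed.

(** * Convergence of the rates *)

Section weak_convergence.
Variables (R : realType) (Y : completePseudoMetricType R).
Variable M : probability (borel Y) R.
Variables (zeta : forall N : nat, 'I_N -> Y) (p : forall N : nat, 'I_N -> R).
Hypothesis p_ge0 : forall (N : nat) (k : 'I_N), 0 <= p k.
Hypothesis p_cvg : forall f : Y -> R, continuous f ->
  M.-integrable [set: borel Y] (fun y => (f y)%:E) ->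
  \sum_(k < N) f (zeta k) * p k @[N --> \oo] --> \int[M]_y f y.

Lemma integrable_continuous01 (f : Y -> R) : continuous f ->
  (forall y, 0 <= f y <= 1) -> M.-integrable [set: borel Y] (fun y => (f y)%:E).
Proof.
move=> cf f01; have mf := continuous_borel_measurable cf.
apply/integrableP; split; first exact/measurable_EFinP.
under eq_integral do rewrite gee0_abs ?lee_fin ?(andP (f01 _)).1//.
have := integral_fin_num01 M mf f01.
by rewrite fin_numElt => /andP[].
Qed.

(** A portmanteau argument: M_N(A) lies between M_N(f) and M_N(g), which converge to M(f) and M(g);
    these enclose M(A) and differ by at most e / 2. *)
Lemma jordan_set_cvg (A : set Y) : jordan_set M A -> measurable (A : set (borel Y)) ->
  \sum_(k < N) \1_A (zeta k) * p k @[N --> \oo] --> fine (M (A : set (borel Y))).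
Proof.
move=> jA mA; apply/cvgrPdist_lt => e e0.
have e20 : 0 < e / 2 by rewrite divr_gt0.
have [[f g] /= [cf cg fA gA fg]] := jA _ e20.
have iA y : 0 <= (\1_A y : R) <= 1.
  by rewrite indicE; case: (y \in A); rewrite /= ?lexx ?ler01.
have f01 y : 0 <= f y <= 1 by have := fA y; have := iA y; lra.
have g01 y : 0 <= g y <= 1 by have := gA y; have := iA y; lra.
have gf01 y : 0 <= g y - f y <= 1 by have := fA y; have := gA y; lra.
have mf := continuous_borel_measurable cf.
have mg := continuous_borel_measurable cg.
have mi : measurable_fun setT (\1_A : borel Y -> R) by exact: measurable_indic.
have mgf : measurable_fun setT (fun y : borel Y => g y - f y) by exact: measurable_funB.
have EF (h : borel Y -> R) : measurable_fun setT h -> (forall y, 0 <= h y <= 1) ->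
    (\int[M]_y (h y)%:E = (\int[M]_y h y)%:E)%E.
  by move=> mh h01; rewrite /Rintegral fineK// integral_fin_num01.
have le_int (h1 h2 : borel Y -> R) : measurable_fun setT h1 -> measurable_fun setT h2 ->
    (forall y, 0 <= h1 y <= 1) -> (forall y, 0 <= h2 y <= 1) ->
    (forall y, h1 y <= h2 y) -> \int[M]_y h1 y <= \int[M]_y h2 y.
  move=> mh1 mh2 h1_01 h2_01 h12; rewrite -lee_fin -!EF//.
  apply: ge0_le_integral => //; try exact/measurable_EFinP.
  - by move=> y _; rewrite lee_fin; have /andP[] := h1_01 y.
  - by move=> y _; rewrite lee_fin.
have MA : fine (M (A : set (borel Y))) = \int[M]_y (\1_A y : R).
  by rewrite /Rintegral integral_indic// setIT.
have If : \int[M]_y f y <= \int[M]_y (\1_A y : R).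
  by apply: le_int => // y; have /andP[] := fA y.
have Ig : \int[M]_y (\1_A y : R) <= \int[M]_y g y.
  by apply: le_int => // y; have /andP[] := gA y.
have Ifg : \int[M]_y g y <= \int[M]_y f y + e / 2.
  rewrite EF// lee_fin in fg; apply: le_trans (lerD (lexx _) fg).
  rewrite -lee_fin EFinD -!EF// -ge0_integralD//; last 4 first.
  - by move=> y _; rewrite lee_fin; have /andP[] := f01 y.
  - exact/measurable_EFinP.
  - by move=> y _; rewrite lee_fin; have /andP[] := gf01 y.
  - exact/measurable_EFinP.
  by under [leRHS]eq_integral do rewrite -EFinD addrC subrK.
have /cvgrPdist_lt/(_ _ e20) cvf := p_cvg cf (integrable_continuous01 cf f01).
have /cvgrPdist_lt/(_ _ e20) cvg := p_cvg cg (integrable_continuous01 cg g01).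
near=> N.
have hf : `|\int[M]_y f y - \sum_(k < N) f (zeta k) * p k| < e / 2 by near: N.
have hg : `|\int[M]_y g y - \sum_(k < N) g (zeta k) * p k| < e / 2 by near: N.
have sf : \sum_(k < N) f (zeta k) * p k <= \sum_(k < N) \1_A (zeta k) * p k.
  by apply: ler_sum => k _; rewrite ler_wpM2r//; have /andP[] := fA (zeta k).
have sg : \sum_(k < N) \1_A (zeta k) * p k <= \sum_(k < N) g (zeta k) * p k.
  by apply: ler_sum => k _; rewrite ler_wpM2r//; have /andP[] := gA (zeta k).
move: hf hg; rewrite MA !ltr_norml; lra.
Unshelve. all: by end_near. Qed.

Lemma sum_rates_cvg : \sum_(k < N) p k @[N --> \oo] --> (1 : R).
Proof.
have c1 : continuous (cst 1 : Y -> R) by exact: cst_continuous.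
have := p_cvg c1 (integrable_continuous01 c1 _); rewrite /Rintegral /= integral_cst_prob /=.
under eq_fun do under eq_bigr do rewrite mul1r.
by apply => y; rewrite /= ler01 lexx.
Qed.

Lemma cell_rates_cvg r (iota : Y -> 'I_r) j : good_set M (iota @^-1` [set j]) ->
  group_rates (iota \o @zeta N) (@p N) j @[N --> \oo] --> cell_rate M iota j.
Proof.
move=> [bj jj]; have := jordan_set_cvg jj (baire_set_measurable bj).
rewrite (_ : (fun N => group_rates _ _ j) =
  (fun N => \sum_(k < N) \1_(iota @^-1` [set j]) (zeta k) * p k))//.
apply/funext => N; rewrite /group_rates big_mkcond; apply: eq_bigr => k _.
rewrite indicE; case: eqP => [e|e]; first by rewrite mem_set// mul1r.
by rewrite memNset// mul0r.
Qed.

Hypothesis p_bigO : (fun N : nat => \big[Num.max/0]_(k < N) p k)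
              =O_\oo (fun N : nat => N%:R^-1 : R).

Lemma rates_bound : exists2 C : R, 0 < C &
  \forall N \near \oo, forall k : 'I_N, p k <= C * N%:R^-1.
Proof.
move/eqOP: p_bigO => [C0 [_ C0P]].
(* The big-O bound holds for every constant strictly above C0; this one is also positive. *)
pose C := Num.max C0 0 + 1.
have C0C : C0 < C by rewrite /C (@le_lt_trans _ _ (Num.max C0 0)) ?le_max ?lexx// ltrDl.
exists C; first by rewrite ltr_wpDl// le_max lexx orbT.
have := C0P _ C0C; apply: filterS => N /= + k.
rewrite [X in _ <= _ * X]ger0_norm ?invr_ge0//; apply: le_trans.
apply: le_trans (ler_norm _).
by rewrite (bigmaxD1 k)//= le_max lexx.
Qed.

(** One factor p_k is at most C / N, and the other sums to a bounded quantity. *)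
Lemma sum_sqr_rates_cvg : \sum_(k < N) p k ^+ 2 @[N --> \oo] --> (0 : R).
Proof.
have [C C0 CP] := rates_bound.
apply: (@squeeze_cvgr _ _ _ _ (cst 0) (fun N : nat => C * N%:R^-1 * \sum_(k < N) p k)).
- apply: filterS CP => N pN; apply/andP; split; first by apply: sumr_ge0 => k _; exact: sqr_ge0.
  by rewrite big_distrr; apply: ler_sum => k _; rewrite expr2 ler_wpM2r.
- exact: cvg_cst.
- rewrite [X in _ --> X](_ : _ = C * 0 * 1); last by rewrite mulr0 mul0r.
  apply: cvgM; last exact: sum_rates_cvg.
  apply: cvgM; first exact: cvg_cst.
  apply: (gtr0_cvgV0 _).2 (@cvgr_idn R).
  by near=> N; rewrite ltr0n; near: N; exact: nbhs_infty_gt.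
Unshelve. all: by end_near. Qed.

End weak_convergence.

(** * Limit of the image forms *)

Theorem theorem4p5 (R : realType) (Y : completePseudoMetricType R)
  (polishY : polish_space Y) (compactY : compact [set: Y])
  (M : probability (borel Y) R)
  (P : probability (borel (conf R Y)) R) (poissonP : poisson_process_law M P)
  (zeta : forall N : nat, 'I_N -> Y) (p : forall N : nat, 'I_N -> R)
  (p_ge0 : forall (N : nat) (k : 'I_N), 0 <= p N k)
  (p_bigO : (fun N : nat => \big[Num.max/0]_(k < N) p N k)
              =O_\oo (fun N : nat => N%:R^-1 : R))
  (p_cvg : forall f : Y -> R, continuous f ->
     M.-integrable [set: borel Y] (fun y => (f y)%:E) ->
     \sum_(k < N) f (zeta N k) * p N k @[N --> \oo] --> \int[M]_y f y)
  (d : measure_display) (Omega : nat -> measurableType d)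
  (Pr : forall N : nat, probability (Omega N) R)
  (X : forall N : nat, 'I_N -> {mfun Omega N >-> nat})
  (X_poisson : forall (N : nat) (k : 'I_N) (n : nat),
     distribution (Pr N) (X N k) [set n] = (poisson_law (p N k) n)%:E)
  (X_indep : forall N : nat,
     mutually_independent (Pr N) (fun k : 'I_N => (X N k : Omega N -> nat)))
  (F : conf R Y -> R) (F_Lip : TV_Lip F) (F_dom : domain_D M P F) :
  image_dirichlet_form (zeta N) (Pr N) (X N) F @[N --> \oo]
    --> dirichlet_form M P F.
Proof.
have hausY := polishY.1.
have mg := measurable_mean_grad2 M F_Lip hausY compactY.
have g01 := mean_grad2_01 M F_Lip.
pose D := fine (\int[P]_w (mean_grad2 M F w)%:E).
have dirE : dirichlet_form M P F = D%:E.
  rewrite /D fineK; last exact: integral_fin_num01.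
  by apply: eq_integral => w _; rewrite -mean_grad2E.
have PV N : is_poisson_vec (Pr N) (count_vec (X N)) (p N).
  exact: count_vec_poisson (X_poisson N) (X_indep N).
pose DN N := fine (mean_grad F (zeta N) (Pr N) (X N) (p N)).
have DNE N : mean_grad F (zeta N) (Pr N) (X N) (p N) = (DN N)%:E.
  have e0 : 0 < 1 :> R by [].
  (* Any discretization shows that [mean_grad] is finite; n0 = 0 and e = 1 will do. *)
  have [r [iota [a [gi Frho]]]] := exists_discretization M F_Lip 0 hausY compactY e0.
  have [D' DE _] := mean_grad_discretize F_Lip Frho (zeta N) (p_ge0 N) (PV N).
  by rewrite /DN /mean_grad DE.
have sp := sum_rates_cvg p_cvg.
have DN_D : DN @ \oo --> D.
  apply/cvgrPdist_lt => eps eps0.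
  (* The errors will be 5 e between D and J, e between J and JN, and 12 e between JN and [DN N]: 18
     e in all, well below 96 e. *)
  pose e := eps / 96; have e0 : 0 < e by rewrite divr_gt0.
  have [n0 n0P] : exists n0 : nat, n0.+1%:R^-1 <= e.
    exists (Num.truncn e^-1); rewrite invf_ple ?posrE ?ltr0n// ltW//.
    by have /truncn_itv/andP[] : 0 <= e^-1 by rewrite invr_ge0 ltW.
  have [r [iota [a [gi Frho]]]] := exists_discretization M F_Lip n0 hausY compactY e0.
  have dP := dirichlet_form_discretize F_Lip gi Frho poissonP mg.
  set q := cell_rate M iota in dP; set J := \sum_(j < r) _ in dP.
  pose W N := group_counts (iota \o zeta N) \o count_vec (X N).
  pose qN N := group_rates (iota \o zeta N) (p N).
  have PW N : is_poisson_vec (Pr N) (W N) (qN N) by exact: poisson_vec_group.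
  have PC := cell_counts_poisson poissonP gi.
  have cq j : qN N j @[N --> \oo] --> q j by exact: cell_rates_cvg.
  (* The partition depends on eps but not on N, so this is a fixed finite sum: rates converge cell
     by cell, and expectations by convergence of the mass functions of the counts. *)
  have cJ : \sum_(j < r) qN N j *
      fine (\int[Pr N]_w (cell_grad2 a F (W N w) j)%:E) @[N --> \oo] --> J.
    apply: cvg_big => [|j _]; first exact: add_continuous.
    apply: cvgM; first exact: cq.
    have mW N c : measurable (W N @^-1` [set c]) by exact: (PW N).1.
    have lW c : fine (Pr N (W N @^-1` [set c])) @[N --> \oo] -->
        fine (P ((cell_counts (R := R) iota : borel (conf R Y) -> _) @^-1` [set c])).
      rewrite PC.2 /=; under eq_fun do rewrite (PW _).2 /=.
      by apply: cvg_poisson_vec => // *; [exact: sumr_ge0|exact: cell_rate_ge0].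
    exact: (countable_cvg_integral PC.1 mW lW (f := fun c => cell_grad2 a F c j)
      (fun c => cell_grad2_01 a F_Lip c j)).
  have /cvgrPdist_lt/(_ _ e0) nJ := cJ.
  have /(cvgr_lt _)/(_ 2) n2 := sp.
  near=> N.
  have [D' DE] := mean_grad_discretize F_Lip Frho (zeta N) (p_ge0 N) (PV N).
  have -> : D' = DN N by rewrite /DN /mean_grad DE.
  have s2 : \sum_(k < N) p N k < 2 by near: N; apply: n2; rewrite ltr1n.
  have s0 : 0 <= \sum_(k < N) p N k by exact: sumr_ge0.
  have : `|J - \sum_(j < r) qN N j * fine (\int[Pr N]_w (cell_grad2 a F (W N w) j)%:E)| < e.
    by near: N.
  move: dP; rewrite -/D; set JN := \sum_(j < r) qN N j * _.
  move: (\sum_(k < N) p N k) s0 s2 => s s0 s2 dP JJ.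
  rewrite -/JN => dN.
  (* The bound s (4 e + s / (n0 + 1)) with s < 2 and 1 / (n0 + 1) <= e. *)
  have dN' : `|DN N - JN| <= 2 * (4 * e + 2 * e).
    apply: (le_trans dN); apply: ler_pM => //; [|exact: ltW|].
      by rewrite addr_ge0// ?mulr_ge0 ?divr_ge0// ltW.
    by rewrite lerD2l; apply: ler_pM => //; exact: ltW.
  have e96 : eps = 96 * e by rewrite /e; field.
  have dP' : `|D - J| <= 5 * e.
    by apply: (le_trans dP); rewrite (_ : 5 * e = 4 * e + e) ?lerD2l//; ring.
  rewrite e96; move: (DN N) JJ dN' dP' => x; clearbody D J JN e.
  by rewrite !ler_norml !ltr_norml; lra.
have sq := sum_sqr_rates_cvg p_ge0 p_cvg p_bigO.
have [C C0 CP] := rates_bound p_bigO.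
rewrite dirE.
pose del N := 10 * \sum_(k < N) p N k ^+ 2.
have del0 : del @ \oo --> (0 : R).
  by rewrite -[X in _ --> X](mulr0 10); apply: cvgM; [exact: cvg_cst|exact: sq].
(* The image form is extended-real and not known to be finite for each N, so it is squeezed between
   two real sequences. *)
apply: (@squeeze_cvge _ _ _ _ (fun N => (DN N - del N)%:E) _ (fun N => (DN N + del N)%:E)).
- near=> N.
  (* The one-jump estimate needs rates at most 1, which holds once N >= C. *)
  have p1 k : 0 <= p N k <= 1.
    rewrite p_ge0 /=.
    have pN : forall k, p N k <= C * N%:R^-1 by near: N.
    apply: le_trans (pN k) _; rewrite ler_pdivrMr ?mul1r.
      by near: N; exact: nbhs_infty_ger.
    by rewrite ltr0n; near: N; exact: nbhs_infty_gt.
  have [h1 h2] := image_form_mean_grad F_Lip (zeta N) p1 (X_poisson N) (X_indep N).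
  move: h1 h2; rewrite DNE -/(del N) => h1 h2.
  by rewrite EFinB leeBlDr// h2 EFinD.
- apply: cvg_EFin; first exact: nearW.
  by rewrite -[X in _ --> X]subr0; apply: cvgB.
- apply: cvg_EFin; first exact: nearW.
  by rewrite -[X in _ --> X]addr0; apply: cvgD.
Unshelve. all: by end_near. Qed.
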